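(* There exists an absolute constant $\alpha>0$ such that for every $p>8$, every $E>0$ and every admissible surface $\Sigma\in\mathscr{A}$ with $\mathcal{M}_p(\Sigma)\le E$ the following holds: whenever $x\in\Sigma$, then $$\mathcal{H}^2(B(x,R)\cap\Sigma)\ \ge\ \pi R^2/2$$ for all radii $$0<R\le R_0(E,p):=\left(\frac{\alpha^{5p}}{E}\right)^{\frac{1}{p-8}}.$$
   Context: $B(x,r)$ denotes the closed ball of radius $r$ centered at $x\in\mathbb{R}^3$. For $\varphi\in(0,\pi/2)$ and $w\in\mathbb{S}^2$ put $C^{\pm}(\varphi,w)=\{y\in\mathbb{R}^3:\pm\,y\cdot w\ge|y|\cos\varphi\}$. The class $\mathscr{A}$ of admissible surfaces consists of all compact connected sets $\Sigma\subset\mathbb{R}^3$ with $\Sigma=\partial U$ for some bounded domain $U\subset\mathbb{R}^3$ such that: (i) there is a constant $K=K(\Sigma)$ with $\infty>\mathcal{H}^2(\Sigma\cap B(x,r))\ge K^{-1}r^2$ for all $x\in\Sigma$ and $0<r\le\operatorname{diam}\Sigma$; (ii) there is a dense subset $\Sigma^\ast\subset\Sigma$ such that for each $x\in\Sigma^\ast$ there are $v=v(x)\in\mathbb{S}^2$ and $\delta_0=\delta_0(x)>0$ with $B(x,\delta_0)\cap(x+C^+(\pi/4,v))\subset U\cup\{x\}$ and $B(x,\delta_0)\cap(x+C^-(\pi/4,v))\subset(\mathbb{R}^3\setminus\overline U)\cup\{x\}$. For a tetrahedron $T=(x_0,x_1,x_2,x_3)\in(\mathbb{R}^3)^4$ put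 $\mathcal{K}(T)=\dfrac{V(T)}{A(T)(\operatorname{diam}T)^2}$ if the four vertices are not co-planar, and $\mathcal{K}(T)=0$ otherwise, where $V(T)$ is the volume of $T$ and $A(T)$ is the sum of the areas of its four triangular faces. The integral Menger curvature is $\mathcal{M}_p(\Sigma)=\int_{\Sigma}\int_\Sigma\int_\Sigma\int_\Sigma\mathcal{K}^p(x_0,x_1,x_2,x_3)\,d\mathcal{H}^2(x_0)\,d\mathcal{H}^2(x_1)\,d\mathcal{H}^2(x_2)\,d\mathcal{H}^2(x_3)$, with $\mathcal{H}^2$ the two-dimensional Hausdorff measure. *)

(* Defs.v *)
From HB Require Import structures.
From mathcomp Require Import all_boot all_order all_algebra.
From mathcomp Require Import all_classical all_reals all_analysis.

Set Implicit Arguments.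
Unset Strict Implicit.
Unset Printing Implicit Defensive.

Import Order.TTheory GRing.Theory Num.Theory.
Import numFieldNormedType.Exports.

Local Open Scope classical_set_scope.
Local Open Scope ring_scope.

(* The library norm [`|x|] on ['rV[R]_n] is the sup norm.  It induces the usual
   topology, so the topological notions (open, closure, compact, connected,
   bounded_set) are taken from the library, but every metric notion below is
   built on the Euclidean norm [enorm]. *)
Section euclidean.
Context {R : realType} {n : nat}.
Implicit Types (x y v w : 'rV[R]_n) (A : set 'rV[R]_n).

Definition dotv x y : R := \sum_(i < n) x 0 i * y 0 i.

Definition enorm x : R := Num.sqrt (dotv x x).

Definition eball x (r : R) : set 'rV[R]_n := [set y | enorm (y - x) <= r].

(* The maximum with 0 only matters for A empty, where the supremum is -oo. *)
Definition ediam A : \bar R :=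
  maxe 0%E (ereal_sup [set (enorm (z.1 - z.2))%:E | z in A `*` A]).

Definition cone_pos (phi : R) w : set 'rV[R]_n :=
  [set y | enorm y * cos phi <= dotv y w].

Definition cone_neg (phi : R) w : set 'rV[R]_n :=
  [set y | enorm y * cos phi <= - dotv y w].

Definition translate x A : set 'rV[R]_n := [set x + y | y in A].

Definition boundary A : set 'rV[R]_n := closure A `\` interior A.

Lemma ediam_ge0 A : (0 <= ediam A)%E.
Proof. by rewrite /ediam le_max lexx. Qed.

Lemma ediam0 : ediam set0 = 0%E.
Proof. by rewrite /ediam setX0 image_set0 ereal_sup0 max_l// leNye. Qed.

End euclidean.

Section hausdorff.
Context {R : realType} {n : nat}.
Implicit Types (A : set 'rV[R]_n) (F : nat -> set 'rV[R]_n) (d : R).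
Local Open Scope ereal_scope.

(* Normalized so that H^2 is the area on planes: a set of diameter t
   contributes the area pi (t/2)^2 of a disc of that diameter. *)
Definition gauge2 A : \bar R := (pi / 4)%:E * ediam A ^+ 2.

Definition diam_cover d A : set (nat -> set 'rV[R]_n) :=
  [set F | (forall k, ediam (F k) <= d%:E) /\ A `<=` \bigcup_k F k].

Definition hausdorff2_delta d A : \bar R :=
  ereal_inf [set \sum_(k <oo) gauge2 (F k) | F in diam_cover d A].

Definition hausdorff2 A : \bar R :=
  ereal_sup [set hausdorff2_delta d A | d in [set d | (0 < d)%R]].

Lemma gauge2_ge0 A : 0 <= gauge2 A.
Proof.
by rewrite /gauge2 mule_ge0 ?expe_ge0 ?ediam_ge0// lee_fin divr_ge0// pi_ge0.
Qed.

Lemma gauge20 : gauge2 set0 = 0.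
Proof. by rewrite /gauge2 ediam0 expeS mul0e mule0. Qed.

Lemma hausdorff2_delta_ge0 d A : 0 <= hausdorff2_delta d A.
Proof.
apply: le_ereal_inf_tmp => _ [F _ <-].
by apply: nneseries_ge0 => k _ _; exact: gauge2_ge0.
Qed.

Lemma hausdorff2_delta0 d : (0 < d)%R -> hausdorff2_delta d set0 = 0.
Proof.
move=> d0; apply/eqP; rewrite eq_le hausdorff2_delta_ge0 andbT.
apply: ereal_inf_lbound; exists (fun=> set0).
  by split => // k; rewrite ediam0 lee_fin ltW.
by apply: eseries0 => k _ _; exact: gauge20.
Qed.

Lemma hausdorff2_delta_subadditive d (A : nat -> set 'rV[R]_n) :
  hausdorff2_delta d (\bigcup_k A k) <= \sum_(k <oo) hausdorff2_delta d (A k).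
Proof.
have [[i ioo]|] := pselect (exists i, hausdorff2_delta d (A i) = +oo).
  rewrite (eseries_pinfty _ _ ioo) ?leey// => k _.
  by rewrite -ltNye (lt_le_trans _ (hausdorff2_delta_ge0 _ _)).
rewrite -forallNE => Aoo.
apply/lee_addgt0Pr => e e0.
rewrite (le_trans _ (epsilon_trick _ _ (ltW e0)))//; last first.
  by move=> k; exact: hausdorff2_delta_ge0.
pose P k F := diam_cover d (A k) F /\
  \sum_(j <oo) gauge2 (F j) <= hausdorff2_delta d (A k) + (e / (2 ^ k.+1)%:R)%:E.
have [G PG] : {G : nat -> nat -> set 'rV[R]_n & forall k, P k (G k)}.
  apply: (@choice _ _ P) => k.
  have fk : hausdorff2_delta d (A k) \is a fin_num.
    by rewrite ge0_fin_numE ?hausdorff2_delta_ge0// ltey; exact/eqP/Aoo.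
  have ek : (0 < e / (2 ^ k.+1)%:R)%R by rewrite divr_gt0.
  have [_ [F FA <-] lF] := lb_ereal_inf_adherent ek fk.
  by exists F; split => //; exact: ltW.
have g0 z : 0 <= gauge2 (G z.1 z.2) by exact: gauge2_ge0.
have /card_esym/ppcard_eqP[f] := card_nat2.
apply: (@le_trans _ _ (\sum_(k <oo) gauge2 (G (f k).1 (f k).2))).
  apply: ereal_inf_lbound; exists (fun k => G (f k).1 (f k).2) => //.
  split => [k|t [i _ /(PG i).1.2[j _ Gt]]]; first exact: (PG _).1.1.
  by exists (f^-1%FUN (i, j)) => //=; rewrite invK ?inE.
rewrite (_ : \sum_(k <oo) _ = \sum_(i <oo) \sum_(j <oo) gauge2 (G i j)); last first.
  rewrite nneseries_esumT//.
  have -> : \esum_(k in [set: nat]) gauge2 (G (f k).1 (f k).2) =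
      \esum_(z in [set: nat * nat]) gauge2 (G z.1 z.2).
    by rewrite (reindex_esum [set: nat] setT f).
  pose J : nat -> set (nat * nat) := fun i => [set (i, j) | j in setT].
  rewrite (_ : setT = \bigcup_k J k); last first.
    by rewrite predeqE => -[a b]; split => // _; exists a => //; exists b.
  rewrite esum_bigcupT /=; last 2 first.
  - apply/trivIsetP => i j _ _ ij.
    rewrite predeqE => -[k m] /=; split => //= -[] [_] _ [<-{k} _].
    by move=> [m' _] [] /esym/eqP; rewrite (negbTE ij).
  - by [].
  rewrite nneseries_esumT; last first.
    by move=> i; apply: nneseries_ge0 => j _ _; exact: (g0 (i, j)).
  apply: eq_esum => i _; rewrite nneseries_esumT//; last first.
    by move=> j; exact: (g0 (i, j)).
  rewrite (reindex_esum [set: nat] (J i) (pair i))//; split => // [j _|x y _ _ []//].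
  by exists j.
apply: lee_nneseries => [k _ _|k _]; last exact: (PG k).2.
by apply: nneseries_ge0 => j _ _; exact: (g0 (k, j)).
Qed.

Lemma hausdorff2_delta_le d A : (0 < d)%R -> hausdorff2_delta d A <= hausdorff2 A.
Proof. by move=> d0; apply: ereal_sup_ubound; exists d. Qed.

Lemma hausdorff20 : hausdorff2 set0 = 0.
Proof.
apply/eqP; rewrite eq_le; apply/andP; split.
  by apply: ge_ereal_sup => _ [d /= d0 <-]; rewrite hausdorff2_delta0.
by rewrite -(hausdorff2_delta0 ltr01) hausdorff2_delta_le.
Qed.

Lemma hausdorff2_ge0 A : 0 <= hausdorff2 A.
Proof.
exact: le_trans (hausdorff2_delta_ge0 1 A) (hausdorff2_delta_le A ltr01).
Qed.

Lemma le_hausdorff2 : {homo hausdorff2 : A B / A `<=` B >-> A <= B}.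
Proof.
move=> A B AB; apply: ge_ereal_sup => _ [d /= d0 <-].
apply: le_trans (hausdorff2_delta_le B d0).
apply: ereal_inf_le_tmp => _ [F [Fd BF] <-]; exists F => //.
by split => //; exact: subset_trans AB BF.
Qed.

Lemma hausdorff2_sigma_subadditive : sigma_subadditive hausdorff2.
Proof.
move=> A; apply: ge_ereal_sup => _ [d /= d0 <-].
apply: le_trans (hausdorff2_delta_subadditive d A) _.
apply: lee_nneseries => [k _ _|k _]; first exact: hausdorff2_delta_ge0.
exact: hausdorff2_delta_le.
Qed.

HB.instance Definition _ := isOuterMeasure.Build R 'rV[R]_n hausdorff2
  hausdorff20 hausdorff2_ge0 le_hausdorff2 hausdorff2_sigma_subadditive.

End hausdorff.

(* H^2 as a measure on the sigma-algebra of its Caratheodory measurable sets. *)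
Section hausdorff_measure.
Context {R : realType} {n : nat}.

Let H : {outer_measure set 'rV[R]_n -> \bar R} := @hausdorff2 R n.

HB.instance Definition _ := isMeasure.Build _ _ _
  (@hausdorff2 R n : set (caratheodory_type (@hausdorff2 R n)) -> \bar R)
  (@caratheodory_measure0 R _ H) (@caratheodory_measure_ge0 R _ H)
  (@caratheodory_measure_sigma_additive R _ H).

Definition H2 : {measure set (caratheodory_type (@hausdorff2 R n)) -> \bar R} :=
  (@hausdorff2 R n : set (caratheodory_type (@hausdorff2 R n)) -> \bar R).

End hausdorff_measure.

Section menger.
Context {R : realType}.
Implicit Types (x a b c : 'rV[R]_3) (Sigma U : set 'rV[R]_3).

Definition coplanar x0 x1 x2 x3 : Prop :=
  exists (nu : 'rV[R]_3) (c : R), nu != 0 /\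
    [/\ dotv nu x0 = c, dotv nu x1 = c, dotv nu x2 = c & dotv nu x3 = c].

(* Half the area |u x v| of the parallelogram spanned by u = b - a and
   v = c - a, where |u x v|^2 = |u|^2 |v|^2 - (u . v)^2. *)
Definition triangle_area a b c : R :=
  Num.sqrt (dotv (b - a) (b - a) * dotv (c - a) (c - a)
            - dotv (b - a) (c - a) ^+ 2) / 2.

Definition tetra_area x0 x1 x2 x3 : R :=
  triangle_area x0 x1 x2 + triangle_area x0 x1 x3
  + triangle_area x0 x2 x3 + triangle_area x1 x2 x3.

Definition tetra_volume x0 x1 x2 x3 : R :=
  `|\det (col_mx (x1 - x0) (col_mx (x2 - x0) (x3 - x0)) : 'M[R]_3)| / 6.

(* The diameter of a tetrahedron is that of its set of vertices. *)
Definition tetra_diam x0 x1 x2 x3 : R := fine (ediam [set x0; x1; x2; x3]).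

Definition menger_kernel x0 x1 x2 x3 : R :=
  if `[< coplanar x0 x1 x2 x3 >] then 0
  else tetra_volume x0 x1 x2 x3
       / (tetra_area x0 x1 x2 x3 * tetra_diam x0 x1 x2 x3 ^+ 2).

Definition menger_energy (p : R) Sigma : \bar R :=
  \int[H2]_(x3 in Sigma) \int[H2]_(x2 in Sigma)
    \int[H2]_(x1 in Sigma) \int[H2]_(x0 in Sigma)
      (menger_kernel x0 x1 x2 x3 `^ p)%:E.

Definition bounded_domain U : Prop :=
  [/\ U !=set0, open U, connected U & bounded_set U].

Definition lower_ahlfors_regular Sigma : Prop :=
  exists2 K : R, 0 < K & forall x (r : R), Sigma x ->
    0 < r -> (r%:E <= ediam Sigma)%E ->
    (hausdorff2 (Sigma `&` eball x r) < +oo)%E /\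
    ((K^-1 * r ^+ 2)%:E <= hausdorff2 (Sigma `&` eball x r))%E.

Definition two_sided_cones Sigma U : Prop :=
  exists2 Sigma' : set 'rV[R]_3,
    Sigma' `<=` Sigma /\ Sigma `<=` closure Sigma' &
    forall x, Sigma' x -> exists (v : 'rV[R]_3) (delta : R),
      [/\ enorm v = 1, 0 < delta,
          eball x delta `&` translate x (cone_pos (pi / 4) v)
            `<=` U `|` [set x]
        & eball x delta `&` translate x (cone_neg (pi / 4) v)
            `<=` ~` closure U `|` [set x]].

Definition admissible Sigma : Prop :=
  [/\ compact Sigma, connected Sigma &
      exists U, [/\ bounded_domain U, Sigma = boundary U,
                    lower_ahlfors_regular Sigma & two_sided_cones Sigma U]].

End menger.

(* Main.v *)
Require Import Defs.
From mathcomp Require Import all_boot all_order all_algebra.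
From mathcomp Require Import all_classical all_reals all_analysis.
From mathcomp Require Import ring lra.

Set Implicit Arguments.
Unset Strict Implicit.
Unset Printing Implicit Defensive.

Import Order.TTheory GRing.Theory Num.Theory.
Import numFieldNormedType.Exports.

Local Open Scope classical_set_scope.
Local Open Scope ring_scope.

(** A ball of radius [r] around a point of the surface with too little area is
    played against the energy by means of a tetrahedron of comparable size or
    smaller that is far from degenerate.

    Fix [x] in the dense set of points where two opposite cones are available,
    and call four points of the surface, one of them [x], fat at scale [s] if
    they lie within [s] of [x] and span a volume comparable to [s ^+ 3].  If
    there is no fat tetrahedron with vertex [x] at any scale up to [r], then at
    each of these scales the surface stays in a thin slab around some plane
    through [x] ([small_triple_flat]).  The slab leaves two caps of the ball.  At
    a tiny scale the cones put one of them inside the domain and the other one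
    outside ([cones_split]); the slabs at scales [s] and [2 * s] have a common
    direction that avoids both, so the same holds at all scales up to [r]
    ([splits_propagate]).  A line normal to the slab at scale [r] then has to
    cross the surface, whose projection in the ball therefore has area almost
    [pi * r ^+ 2], nearly twice the area asked for ([splits_area]).  This leaves
    room for the crude comparison of the Hausdorff measure with [pi / 4] times the
    area of a projection ([area_projection_le_hausdorff2]).

    Consequently a ball of radius [r] with deficient area gives a fat
    tetrahedron at some scale [s < r] ([deficient_fat]).  Its kernel stays above
    [c / s] when the vertices move by at most [q * s], so if the balls of radius
    [q * s] carry mass at least [k * (q * s) ^+ 2], the energy is at least a
    multiple of [s `^ (8 - p)], which bounds [s] from below as [8 < p]
    ([fat_energy], [fat_energy_scale]).  Mass in the small balls comes from the
    infimum [D] of the deficient radii.  If [D > 0], start from a deficient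
    radius below [2 * D]; balls of radius [q * s < D] are not deficient, and
    [k = 1] gives the absolute constant.  If [D = 0], Ahlfors regularity gives
    some [k > 0] depending on the surface, which is enough since [s] can then be
    taken as small as desired.

    The iterated integral is bounded from below on closed balls; these are
    measurable by Caratheodory's criterion for metric outer measures
    ([closed_caratheodory]). *)

(** * Euclidean geometry *)

Section euclidean_norm.
Context {R : realType} {n : nat}.
Implicit Types (x y z : 'rV[R]_n) (A B : set 'rV[R]_n).

Lemma dotvC x y : dotv x y = dotv y x.
Proof. by apply: eq_bigr => i _; rewrite mulrC. Qed.

Lemma dotvDl x y z : dotv (x + y) z = dotv x z + dotv y z.
Proof. by rewrite -big_split; apply: eq_bigr => i _; rewrite mxE mulrDl. Qed.

Lemma dotvZl a x y : dotv (a *: x) y = a * dotv x y.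
Proof. by rewrite mulr_sumr; apply: eq_bigr => i _; rewrite mxE mulrA. Qed.

Lemma dotvNl x y : dotv (- x) y = - dotv x y.
Proof. by rewrite -scaleN1r dotvZl mulN1r. Qed.

Lemma dotvBl x y z : dotv (x - y) z = dotv x z - dotv y z.
Proof. by rewrite dotvDl dotvNl. Qed.

Lemma dotvDr x y z : dotv x (y + z) = dotv x y + dotv x z.
Proof. by rewrite dotvC dotvDl !(dotvC x). Qed.

Lemma dotvZr a x y : dotv x (a *: y) = a * dotv x y.
Proof. by rewrite dotvC dotvZl (dotvC x). Qed.

Lemma dotvNr x y : dotv x (- y) = - dotv x y.
Proof. by rewrite dotvC dotvNl (dotvC x). Qed.

Lemma dotv_ge0 x : 0 <= dotv x x.
Proof. by apply: sumr_ge0 => i _; rewrite -expr2 sqr_ge0. Qed.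

Lemma enorm_ge0 x : 0 <= enorm x.
Proof. exact: sqrtr_ge0. Qed.

Lemma sqr_enorm x : enorm x ^+ 2 = dotv x x.
Proof. by rewrite sqr_sqrtr// dotv_ge0. Qed.

Lemma enorm0 : enorm (0 : 'rV[R]_n) = 0.
Proof.
by rewrite /enorm /dotv big1 ?sqrtr0// => i _; rewrite mxE mul0r.
Qed.

Lemma enormZ a x : enorm (a *: x) = `|a| * enorm x.
Proof.
by rewrite /enorm dotvZl dotvZr mulrA -expr2 sqrtrM ?sqr_ge0// sqrtr_sqr.
Qed.

Lemma enormN x : enorm (- x) = enorm x.
Proof. by rewrite /enorm dotvNl dotvNr opprK. Qed.

Lemma enormBC x y : enorm (x - y) = enorm (y - x).
Proof. by rewrite -enormN opprB. Qed.

Lemma ler_coord_enorm x i : `|x 0 i| <= enorm x.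
Proof.
rewrite -sqrtr_sqr ler_wsqrtr// /dotv (bigD1 i)//= expr2 lerDl.
by apply: sumr_ge0 => j _; rewrite -expr2 sqr_ge0.
Qed.

Lemma enorm_eq0 x : (enorm x == 0) = (x == 0).
Proof.
apply/idP/eqP => [/eqP x0|->]; last by rewrite enorm0.
apply/rowP => i; rewrite mxE; apply/eqP; rewrite -normr_le0 -x0.
exact: ler_coord_enorm.
Qed.

Lemma enorm_gt0 x : (0 < enorm x) = (x != 0).
Proof. by rewrite lt0r enorm_eq0 enorm_ge0 andbT. Qed.

Lemma cauchy_schwarz x y : `|dotv x y| <= enorm x * enorm y.
Proof.
have [->|y0] := eqVneq y 0.
  by rewrite enorm0 mulr0 /dotv big1 ?normr0// => i _; rewrite mxE mulr0.
have ny : 0 < enorm y ^+ 2 by rewrite exprn_gt0// enorm_gt0.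
rewrite -ler_sqr ?nnegrE ?mulr_ge0 ?enorm_ge0//.
rewrite real_normK ?num_real// exprMn.
have := dotv_ge0 (enorm y ^+ 2 *: x - dotv x y *: y).
rewrite dotvBl !(dotvC _ (_ - _)) !dotvBl !dotvZl !(dotvC _ (_ *: _)) !dotvZl.
rewrite -!sqr_enorm (dotvC y x).
rewrite (_ : _ - _ = enorm y ^+ 2 * (enorm x ^+ 2 * enorm y ^+ 2 - dotv x y ^+ 2)).
  by rewrite pmulr_rge0// subr_ge0.
by ring.
Qed.

Lemma ler_dotv x y : dotv x y <= enorm x * enorm y.
Proof. exact: le_trans (ler_norm _) (cauchy_schwarz x y). Qed.

Lemma ler_enormD x y : enorm (x + y) <= enorm x + enorm y.
Proof.
rewrite -ler_sqr ?nnegrE ?addr_ge0 ?enorm_ge0//.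
rewrite sqrrD !sqr_enorm dotvDl !dotvDr (dotvC y x).
have := ler_dotv x y; lra.
Qed.

Lemma ler_enorm_distD z x y : enorm (x - y) <= enorm (x - z) + enorm (z - y).
Proof. by apply: le_trans (ler_enormD _ _); rewrite addrA subrK. Qed.

Lemma ler_norm_enorm x : `|x| <= enorm x.
Proof.
rewrite [leLHS]mx_normrE; apply: bigmax_le => [|[i j] _ /=]; first exact: enorm_ge0.
by rewrite ord1; exact: ler_coord_enorm.
Qed.

Lemma ler_enorm_norm x : enorm x <= n%:R * `|x|.
Proof.
rewrite -ler_sqr ?nnegrE ?enorm_ge0 ?mulr_ge0// sqr_enorm.
have xi i : `|x 0 i| <= `|x|.
  by rewrite [leRHS]mx_normrE; apply/bigmax_geP; right; exists (0, i).
apply: (@le_trans _ _ (\sum_(i < n) `|x| ^+ 2)).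
  apply: ler_sum => i _; rewrite -expr2 -[leLHS]real_normK ?num_real//.
  by rewrite ler_sqr ?nnegrE.
rewrite sumr_const card_ord exprMn -[leLHS]mulr_natl ler_wpM2r ?sqr_ge0//.
by rewrite -natrX ler_nat; case: n => // m; rewrite expnS leq_pmulr ?expn_gt0.
Qed.

Lemma closure_enormP A x :
  closure A x <-> forall e, 0 < e -> exists2 y, A y & enorm (y - x) <= e.
Proof.
split=> [Ax e e0|Ax].
  have d0 : 0 < e / n.+1%:R by rewrite divr_gt0.
  have [y [Ay]] := Ax _ (nbhsx_ballx x _ d0).
  rewrite -ball_normE /= distrC => yx; exists y => //.
  apply: le_trans (ler_enorm_norm _) _.
  apply: (@le_trans _ _ (n.+1%:R * `|y - x|)); first by rewrite ler_wpM2r// ler_nat.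
  by rewrite mulrC -ler_pdivlMr// ltW.
move=> B /nbhs_ballP[e /= e0 eB].
have [|y Ay yx] := Ax (e / 2); first by rewrite divr_gt0.
exists y; split => //; apply: eB; rewrite -ball_normE /= distrC.
apply: (le_lt_trans (ler_norm_enorm _)); apply: (le_lt_trans yx).
by rewrite ltr_pdivrMr// ltr_pMr// ltr1n.
Qed.

Lemma closed_eball x r : closed (eball x r).
Proof.
move=> y /closure_enormP xy; rewrite /eball /=.
apply/ler_addgt0Pr => e e0; have [z xz zy] := xy e e0.
apply: le_trans (ler_enorm_distD z _ _) _.
by rewrite addrC lerD// enormBC.
Qed.

Lemma enorm_le_ediam A x y : A x -> A y -> ((enorm (x - y))%:E <= ediam A)%E.
Proof.
move=> Ax Ay; rewrite /ediam le_max; apply/orP; right.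
by apply: ereal_sup_ubound; exists (x, y).
Qed.

Lemma ediam_le A d : 0 <= d -> (forall x y, A x -> A y -> enorm (x - y) <= d) ->
  (ediam A <= d%:E)%E.
Proof.
move=> d0 Ad; rewrite /ediam ge_max lee_fin d0 /=.
by apply: ge_ereal_sup => _ [[x y] /= [Ax Ay] <-]; rewrite lee_fin Ad.
Qed.

Lemma le_ediam A B : A `<=` B -> (ediam A <= ediam B)%E.
Proof.
move=> AB; rewrite {1}/ediam ge_max ediam_ge0 /=.
by apply: ge_ereal_sup => _ [[x y] /= [Ax Ay] <-]; apply: enorm_le_ediam; exact: AB.
Qed.

End euclidean_norm.

(** * The Hausdorff measure is a metric outer measure *)

Section metric_outer_measure.
Context {R : realType} {n : nat}.
Implicit Types (A B C X : set 'rV[R]_n).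
Local Open Scope ereal_scope.

Lemma le_gauge2 A B : A `<=` B -> gauge2 A <= gauge2 B.
Proof.
move=> AB; rewrite /gauge2 lee_wpmul2l ?lee_fin ?divr_ge0 ?pi_ge0//.
by rewrite !expe2; apply: lee_pmul; rewrite ?ediam_ge0 ?le_ediam.
Qed.

Lemma hausdorff2_delta_anti d d' A : (d <= d')%R ->
  hausdorff2_delta d' A <= hausdorff2_delta d A.
Proof.
move=> dd'; apply: ereal_inf_le_tmp => _ [F [Fd AF] <-]; exists F => //.
by split=> // k; rewrite (le_trans (Fd k))// lee_fin.
Qed.

(** A set of diameter at most the gap between [A] and [B] meets only one of
    them, so a fine cover of the union splits without loss. *)
Lemma hausdorff2_delta_separated d A B :
  (forall x y, A x -> B y -> (d < enorm (x - y))%R) ->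
  hausdorff2_delta d A + hausdorff2_delta d B <= hausdorff2_delta d (A `|` B).
Proof.
move=> AB; apply: le_ereal_inf_tmp => _ [F [Fd ABF] <-].
have le_dF D : D `<=` A `|` B ->
    hausdorff2_delta d D <= \sum_(k <oo) gauge2 (F k `&` D).
  move=> DAB; apply: ereal_inf_lbound; exists (fun k => F k `&` D) => //.
  split=> [k|x Dx]; first by apply: le_trans (Fd k); exact/le_ediam.
  by have [k _ Fx] := ABF _ (DAB _ Dx); exists k.
apply: le_trans (leeD (le_dF A _) (le_dF B _)) _; [exact: subsetUl|exact: subsetUr|].
rewrite -nneseriesD; try by move=> *; exact: gauge2_ge0.
apply: lee_nneseries => [k _ _|k _]; first by rewrite adde_ge0 ?gauge2_ge0.
have [FA|/set0P[x [Fx Ax]]] := eqVneq (F k `&` A) set0.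
  by rewrite FA gauge20 add0e le_gauge2.
rewrite (_ : F k `&` B = set0) ?gauge20 ?adde0 ?le_gauge2// -subset0 => y [Fy By].
have := le_trans (enorm_le_ediam Fx Fy) (Fd k).
by rewrite lee_fin leNgt AB.
Qed.

Lemma hausdorff2_separated d A B : (0 < d)%R ->
  (forall x y, A x -> B y -> (d < enorm (x - y))%R) ->
  hausdorff2 A + hausdorff2 B <= hausdorff2 (A `|` B).
Proof.
move=> d0 AB.
have [->|fU] := eqVneq (hausdorff2 (A `|` B)) +oo; first exact: leey.
have fin D : D `<=` A `|` B -> hausdorff2 D \is a fin_num.
  move=> DU; rewrite ge0_fin_numE ?hausdorff2_ge0//.
  by apply: le_lt_trans (le_hausdorff2 DU) _; rewrite ltey.
rewrite -leeBrDr; last by apply: fin; exact: subsetUr.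
apply: ge_ereal_sup => _ [a /= a0 <-].
have fa : hausdorff2_delta a A \is a fin_num.
  rewrite ge0_fin_numE ?hausdorff2_delta_ge0//.
  apply: le_lt_trans (hausdorff2_delta_le A a0) _.
  by rewrite -ge0_fin_numE ?hausdorff2_ge0//; apply: fin; exact: subsetUl.
rewrite leeBrDr; last by apply: fin; exact: subsetUr.
rewrite addeC -leeBrDr//; apply: ge_ereal_sup => _ [b /= b0 <-].
rewrite leeBrDr//.
pose m := Num.min d (Num.min a b).
have m0 : (0 < m)%R by rewrite !lt_min d0 a0.
apply: (le_trans _ (hausdorff2_delta_le _ m0)).
apply: le_trans (hausdorff2_delta_separated (d := m) _); last first.
  by move=> x y Ax By; rewrite (le_lt_trans _ (AB x y Ax By))// ge_min lexx.
by rewrite addeC; apply: leeD; apply: hausdorff2_delta_anti; rewrite !ge_min lexx ?orbT.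
Qed.

(** Caratheodory's criterion.  [Y k] is the part of [X] at distance at least
    [1 / (k + 1)] from the closed set [C].  The shell [Y k.+2 `\` Y k.+1] is at
    positive distance from [Y k], so the masses of the shells telescope and are
    summable; hence the mass of [X `\` C] lying outside [Y k] tends to 0. *)
Lemma closed_caratheodory C : closed C -> (@hausdorff2 R n).-caratheodory C.
Proof.
move=> clC; apply: (@le_caratheodory_measurable R _ (@hausdorff2 R n)) => X.
change (hausdorff2 (X `&` C) + hausdorff2 (X `&` ~` C) <= hausdorff2 X).
have [->|fX] := eqVneq (hausdorff2 X) +oo; first exact: leey.
pose Y k := X `&` [set x | forall c, C c -> (k.+1%:R^-1 <= enorm (x - c))%R].
pose r k := (k.+1%:R^-1 : R)%R.
have r_anti k : (r k.+1 < r k)%R by rewrite ltf_pV2 ?posrE ?ltr_nat.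
have Yhomo k : Y k `<=` Y k.+1.
  by move=> x [Xx xC]; split=> // c /xC; exact/le_trans/ltW/r_anti.
have YX k : Y k `<=` X by move=> x [].
pose S k := Y k.+1 `\` Y k.
have finX D : D `<=` X -> hausdorff2 D \is a fin_num.
  move=> DX; rewrite ge0_fin_numE ?hausdorff2_ge0//.
  by apply: le_lt_trans (le_hausdorff2 DX) _; rewrite ltey.
have S_sep k : hausdorff2 (Y k) + hausdorff2 (S k.+1) <= hausdorff2 (Y k.+2).
  apply: (@le_trans _ _ (hausdorff2 (Y k `|` S k.+1))); last first.
    by apply: le_hausdorff2 => x [/Yhomo/Yhomo//|[]].
  apply: (@hausdorff2_separated ((r k - r k.+1) / 2)%R).
    by rewrite divr_gt0// subr_gt0.
  move=> x y [Xx xC] [[Xy _] /not_andP[//|/existsNP[c /not_implyP[Cc /negP]]]].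
  rewrite -ltNge -/(r k.+1) => yc.
  have := xC c Cc; rewrite -/(r k) => xc.
  have := ler_enorm_distD y x c; have := r_anti k; lra.
have S_sum N : \sum_(0 <= k < N) hausdorff2 (S k.+1) <=
    hausdorff2 (Y N) + hausdorff2 (Y N.+1).
  elim: N => [|N IH]; first by rewrite big_nil adde_ge0 ?hausdorff2_ge0.
  rewrite big_nat_recr//=; apply: le_trans (leeD2r _ IH) _.
  by rewrite addeAC addeC leeD2l.
have S_ge0 k : 0 <= hausdorff2 (S k) by exact: hausdorff2_ge0.
have S_fin : \sum_(k <oo) hausdorff2 (S k) < +oo.
  rewrite (nneseries_recl (P := xpredT) (fun k _ => S_ge0 k))//.
  rewrite -(nneseries_addn _ S_ge0).
  apply: lte_add_pinfty; first by rewrite -ge0_fin_numE ?hausdorff2_ge0// finX// => x [[]].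
  apply: (@le_lt_trans _ _ (hausdorff2 X + hausdorff2 X)); last first.
    by rewrite lte_add_pinfty// ltey.
  apply: lime_le; first by apply: is_cvg_nneseries => *; exact: hausdorff2_ge0.
  apply: nearW => N; rewrite (eq_bigr (fun k => hausdorff2 (S k.+1))) => [|k _];
    last by rewrite addn1.
  by apply: le_trans (S_sum N) _; apply: leeD; apply: le_hausdorff2.
have XC N : X `&` ~` C `<=` Y N `|` \bigcup_k S (k + N)%N.
  move=> x [Xx Cx].
  have [M YM] : exists M, Y M x.
    have [e e0 xe] : exists2 e : R, (0 < e)%R & forall c, C c -> (e <= enorm (x - c))%R.
      apply: contrapT => /forall2NP xC; apply: Cx.
      rewrite (closure_id C).1//; apply/closure_enormP => e e0.
      have [//|/existsNP[c /not_implyP[Cc /negP]]] := xC e.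
      by rewrite -ltNge => ec; exists c => //; rewrite enormBC ltW.
    exists (Num.truncn e^-1); split=> // c /xe; apply: le_trans.
    by rewrite invf_ple ?posrE// ltW// truncnS_gt.
  elim: M YM => [|M IH] YM.
    by left; elim: N => // N; exact: Yhomo.
  have [/IH//|YM'] := pselect (Y M x).
  have [MN|NM] := ltnP M N; last by right; exists (M - N)%N => //; rewrite subnK.
  left; rewrite -(subnK MN); elim: (N - _)%N => // k; exact: Yhomo.
have le_tail N : hausdorff2 (X `&` C) + hausdorff2 (X `&` ~` C) <=
    hausdorff2 X + \sum_(N <= k <oo) hausdorff2 (S k).
  have sepN : hausdorff2 (X `&` C) + hausdorff2 (Y N) <= hausdorff2 X.
    apply: (@le_trans _ _ (hausdorff2 (X `&` C `|` Y N))); last first.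
      by apply: le_hausdorff2 => x [[]|/YX].
    apply: (@hausdorff2_separated (r N / 2)%R); first by rewrite divr_gt0// /r invr_gt0.
    move=> x y [_ Cx] [_ /(_ x Cx)]; rewrite -/(r N) enormBC.
    by apply: lt_le_trans; rewrite ltr_pdivrMr// ltr_pMr ?ltr1n// /r invr_gt0.
  apply: le_trans (leeD2r _ sepN); rewrite -addeA leeD2l//.
  apply: (le_trans (le_hausdorff2 (XC N))).
  apply: (le_trans (@outer_measureU2 _ _ (@hausdorff2 R n) _ _)).
  rewrite leeD2l//; apply: (le_trans (hausdorff2_sigma_subadditive _)).
  by rewrite (nneseries_addn _ S_ge0).
have tail0 : \sum_(N <= k <oo) hausdorff2 (S k) @[N --> \oo] --> 0.
  by apply: nneseries_tail_cvg => // k _; exact: hausdorff2_ge0.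
have cvgX : hausdorff2 X + \sum_(N <= k <oo) hausdorff2 (S k) @[N --> \oo] --> hausdorff2 X.
  rewrite -[X in _ --> X]adde0; apply: cvgeD => //; last exact: cvg_cst.
  by apply: fin_num_adde_defr; exact: finX.
rewrite -(cvg_lim _ cvgX)//; apply: lime_ge; first by apply/cvg_ex; exists (hausdorff2 X).
exact: nearW.
Qed.

End metric_outer_measure.

(** * Cross and triple products *)

Section triple_product.
Context {R : realType}.
Implicit Types (a b c u v : 'rV[R]_3).

Lemma dotv3E u v : dotv u v = u 0 0 * v 0 0 + u 0 1 * v 0 1 + u 0 2 * v 0 2.
Proof.
rewrite /dotv !big_ord_recl big_ord0 addr0 addrA.
by do 2?congr (_ + _); congr (u _ _ * v _ _); exact: val_inj.
Qed.

(** The indices are added in [Z/3Z]. *)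
Definition crossv u v : 'rV[R]_3 :=
  \row_(j < 3) (u 0 (j + 1) * v 0 (j + 2) - u 0 (j + 2) * v 0 (j + 1)).

Definition tripv a b c : R := dotv a (crossv b c).

Lemma crossvE u v :
  ((crossv u v 0 0 = u 0 1 * v 0 2 - u 0 2 * v 0 1) *
   (crossv u v 0 1 = u 0 2 * v 0 0 - u 0 0 * v 0 2) *
   (crossv u v 0 2 = u 0 0 * v 0 1 - u 0 1 * v 0 0))%type.
Proof.
by split; [split|]; rewrite mxE; congr (u _ _ * v _ _ - u _ _ * v _ _); exact: val_inj.
Qed.

Lemma rV3P u v : u 0 0 = v 0 0 -> u 0 1 = v 0 1 -> u 0 2 = v 0 2 -> u = v.
Proof.
move=> h0 h1 h2; apply/rowP => -[[|[|[|//]]] i3].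
- by rewrite (_ : Ordinal i3 = 0) //; exact: val_inj.
- by rewrite (_ : Ordinal i3 = 1) //; exact: val_inj.
- by rewrite (_ : Ordinal i3 = 2) //; exact: val_inj.
Qed.

Lemma tripvE a b c : tripv a b c =
  a 0 0 * (b 0 1 * c 0 2 - b 0 2 * c 0 1) +
  a 0 1 * (b 0 2 * c 0 0 - b 0 0 * c 0 2) +
  a 0 2 * (b 0 0 * c 0 1 - b 0 1 * c 0 0).
Proof. by rewrite /tripv dotv3E !crossvE. Qed.

Lemma dotv_crossl u v : dotv u (crossv u v) = 0.
Proof. by rewrite dotv3E !crossvE; ring. Qed.

Lemma dotv_crossr u v : dotv v (crossv u v) = 0.
Proof. by rewrite dotv3E !crossvE; ring. Qed.

Lemma dotv_crossv u v :
  dotv (crossv u v) (crossv u v) = dotv u u * dotv v v - dotv u v ^+ 2.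
Proof. by rewrite !dotv3E !crossvE; ring. Qed.

Lemma enorm_crossv_le u v : enorm (crossv u v) <= enorm u * enorm v.
Proof.
rewrite -ler_sqr ?nnegrE ?mulr_ge0 ?enorm_ge0// exprMn !sqr_enorm dotv_crossv.
by rewrite gerBl sqr_ge0.
Qed.

(** Hadamard's inequality, from the Cauchy-Schwarz inequality and [|b x c| <= |b| |c|]. *)
Lemma tripv_le a b c : `|tripv a b c| <= enorm a * (enorm b * enorm c).
Proof.
apply: le_trans (cauchy_schwarz _ _) _.
by rewrite ler_wpM2l ?enorm_ge0// enorm_crossv_le.
Qed.

Lemma tripv_perturb a b c a' b' c' : tripv a' b' c' - tripv a b c =
  tripv (a' - a) b' c' + tripv a (b' - b) c' + tripv a b (c' - c).
Proof. by rewrite !tripvE !mxE; ring. Qed.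

(** Cramer's rule; it shows that only the zero vector is orthogonal to all edges
    of a nondegenerate tetrahedron. *)
Lemma tripv_cramer a b c v : tripv a b c *: v =
  dotv v a *: crossv b c + dotv v b *: crossv c a + dotv v c *: crossv a b.
Proof.
have addE u w j : (u + w) 0 j = u 0 j + w 0 j by rewrite mxE.
have scaleE k u j : (k *: u) 0 j = k * u 0 j by rewrite mxE.
by rewrite !dotv3E tripvE; apply: rV3P; rewrite !(addE, scaleE, crossvE); ring.
Qed.

Lemma det_mx33 (A : 'M[R]_3) : \det A =
  A 0 0 * (A 1 1 * A 2 2 - A 1 2 * A 2 1) +
  A 0 1 * (A 1 2 * A 2 0 - A 1 0 * A 2 2) +
  A 0 2 * (A 1 0 * A 2 1 - A 1 1 * A 2 0).
Proof.
rewrite (expand_det_row _ 0) !big_ord_recl big_ord0 /cofactor.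
rewrite !(expand_det_row _ 0) !big_ord_recl !big_ord0 /cofactor !det_mx11 !mxE.
pose f i j := A (inord i) (inord j).
have AE i j : A i j = f i j by rewrite /f !inord_val.
by rewrite !{}AE /= /bump /= !exprS !expr0; ring.
Qed.

Lemma det_tripv a b c : \det (col_mx a (col_mx b c) : 'M[R]_3) = tripv a b c.
Proof.
rewrite det_mx33; set M := col_mx _ _.
have M0 j : M 0 j = a 0 j.
  by rewrite -(col_mxEu a (col_mx b c) 0 j); congr (M _ _); exact: val_inj.
have M1 j : M 1 j = b 0 j.
  rewrite -(col_mxEu b c 0 j) -(col_mxEd a (col_mx b c) (lshift 1 0) j).
  by congr (M _ _); exact: val_inj.
have M2 j : M 2 j = c 0 j.
  rewrite -(col_mxEd b c 0 j) -(col_mxEd a (col_mx b c) (rshift 1 0) j).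
  by congr (M _ _); exact: val_inj.
by rewrite tripvE !M0 !M1 !M2.
Qed.

End triple_product.

(** * Area and planar projections *)

Section projection.
Context {R : realType}.
Local Notation mu := (@lebesgue_measure R).
Local Notation area := (mu \x mu)%E.

Lemma area_box (A B : set R) : measurable A -> measurable B ->
  area (A `*` B) = (mu A * mu B)%E.
Proof.
move=> mA mB.
exact: (product_measure1E (mu : measure (measurableTypeR R) R)
  (mu : {sigma_finite_measure set (measurableTypeR R) -> \bar R}) mA mB).
Qed.

Lemma area_setU (A B : set (R * R)) : measurable A -> measurable B ->
  A `&` B = set0 -> area (A `|` B) = (area A + area B)%E.
Proof.
move=> mA mB AB.
exact: (measureU ((mu : measure (measurableTypeR R) R) \x
  (mu : {sigma_finite_measure set (measurableTypeR R) -> \bar R}))%E mA mB AB).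
Qed.

(** A set of diameter [d] projects into a square of side [d]; the gauge of the
    set is [pi / 4] times the area of that square.  The bound is not sharp, but
    its use below leaves room for the factor [pi / 4]. *)
Lemma area_projection_le_hausdorff2 n (S : set 'rV[R]_n) (f g : 'rV[R]_n -> R)
    (G : set (R * R)) :
  (forall x y, `|f x - f y| <= enorm (x - y)) ->
  (forall x y, `|g x - g y| <= enorm (x - y)) ->
  measurable G -> G `<=` [set (f x, g x) | x in S] ->
  ((pi / 4)%:E * area G <= hausdorff2 S)%E.
Proof.
move=> fL gL mG GS; apply: le_trans (hausdorff2_delta_le S ltr01).
apply: le_ereal_inf_tmp => _ [F [Fd SF] <-].
pose d k := fine (ediam (F k)).
have finF k : ediam (F k) \is a fin_num.
  by rewrite ge0_fin_numE ?ediam_ge0// (le_lt_trans (Fd k)) ?ltry.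
have dE k : ediam (F k) = (d k)%:E by rewrite fineK.
have d0 k : 0 <= d k by rewrite -lee_fin -dE ediam_ge0.
pose I (h : 'rV[R]_n -> R) k : set R := `[inf (h @` F k), inf (h @` F k) + d k]%classic.
have muI h k : mu (I h k) = (d k)%:E.
  rewrite lebesgue_measure_itv/= lte_fin ltrDl -EFinB addrAC subrr add0r.
  by case: ltP => // dk; congr EFin; apply/eqP; rewrite eq_le d0 dk.
have FI (h : 'rV[R]_n -> R) k x : (forall x y, `|h x - h y| <= enorm (x - y)) ->
    F k x -> I h k (h x).
  move=> hL Fx; have hd y : F k y -> h x - d k <= h y.
    move=> Fy; rewrite lerBlDr addrC -lerBlDr; apply: le_trans (ler_norm _) _.
    by rewrite (le_trans (hL _ _))// -lee_fin -dE; exact: enorm_le_ediam.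
  have lbF : lbound (h @` F k) (h x - d k) by move=> _ [y Fy <-]; exact: hd.
  rewrite /I /= in_itv/=; apply/andP; split.
    by apply: ge_inf; [exists (h x - d k)|exists x].
  by rewrite -lerBlDr; apply: lb_le_inf => //; exists (h x); exists x.
have mI h k : measurable (I h k) by exact: measurable_itv.
have GI : G `<=` \bigcup_k (I f k `*` I g k).
  by move=> _ /GS [x /SF[k _ Fx] <-]; exists k => //; split; exact: FI.
have mII k : measurable (I f k `*` I g k) by exact: measurableX.
apply: le_trans (lee_wpmul2l _ (measure_sigma_subadditive area mII mG GI)) _.
  by rewrite lee_fin divr_ge0// pi_ge0.
rewrite -nneseriesZl//; apply: lee_nneseries => [k _ _|k _].
  by rewrite mule_ge0// lee_fin divr_ge0// pi_ge0.
rewrite [X in (_ * X)%E](_ : _ = (d k)%:E * (d k)%:E)%E; last first.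
  by rewrite -{1}(muI f k) -(muI g k); exact: area_box.
by rewrite /gauge2 dE expe2.
Qed.

(** A cross made of two rectangles fits in the disc of radius
    [sqrt (15 / 16) * r]; its area [54 / 25 * r ^+ 2] exceeds [2 * r ^+ 2]. *)
Lemma cross_area_ge (r : R) : 0 < r ->
  exists G : set (R * R), [/\ measurable G,
    (forall z, G z -> z.1 ^+ 2 + z.2 ^+ 2 <= 15 / 16 * r ^+ 2) &
    ((2 * r ^+ 2)%:E <= area G)%E].
Proof.
move=> r0; pose a := 3 / 4 * r; pose b := 3 / 5 * r.
pose G1 : set (R * R) := `[-a, a]%classic `*` `[-b, b]%classic.
pose G2 : set (R * R) := `[-b, b]%classic `*` `]b, a]%classic.
pose G3 : set (R * R) := `[-b, b]%classic `*` `[-a, -b[%classic.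
have m1 : measurable G1 by apply: measurableX; exact: measurable_itv.
have m2 : measurable G2 by apply: measurableX; exact: measurable_itv.
have m3 : measurable G3 by apply: measurableX; exact: measurable_itv.
exists (G1 `|` G2 `|` G3); split.
- by do 2?apply: measurableU.
- move=> [x y] [[|]|] [/=]; rewrite !in_itv/= => /andP[x1 x2] /andP[y1 y2];
    rewrite /a /b in x1 x2 y1 y2; nra.
- have ab : b < a by rewrite /a /b; lra.
  have b0 : 0 < b by rewrite /b; lra.
  have d12 : G1 `&` G2 = set0.
    rewrite -subset0 => -[x y] [[_ /=]]; rewrite in_itv/= => /andP[y1 y2] [_ /=].
    by rewrite in_itv/= => /andP[y3 y4]; lra.
  have d3 : (G1 `|` G2) `&` G3 = set0.
    rewrite -subset0 => -[x y] [[|] [_ /=]]; rewrite in_itv/= => /andP[y1 y2] [_ /=];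
      rewrite in_itv/= => /andP[y3 y4]; lra.
  have itvE (u v : R) b1 b2 : u < v ->
      mu [set` Interval (BSide b1 u) (BSide b2 v)] = (v - u)%:E.
    by move=> uv; rewrite lebesgue_measure_itv/= lte_fin uv.
  rewrite (area_setU _ _ d3)//; last exact: measurableU.
  rewrite (area_setU _ _ d12)// !area_box; try exact: measurable_itv.
  rewrite !itvE; [|lra..].
  by rewrite -!EFinM -!EFinD lee_fin /a /b; nra.
Qed.

(** As [pi / 4 * 2 = pi / 2], an area of [2 * r ^+ 2] in the projection is
    enough, and the disc contains such an area. *)
Lemma disc_projection_hausdorff2 n (S : set 'rV[R]_n) (f g : 'rV[R]_n -> R) r :
  (forall x y, `|f x - f y| <= enorm (x - y)) ->
  (forall x y, `|g x - g y| <= enorm (x - y)) ->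
  0 < r ->
  (forall p q, p ^+ 2 + q ^+ 2 <= 15 / 16 * r ^+ 2 ->
     exists2 x, S x & f x = p /\ g x = q) ->
  ((pi * r ^+ 2 / 2)%:E <= hausdorff2 S)%E.
Proof.
move=> fL gL r0 disc; have [G [mG Gdisc Gr]] := cross_area_ge r0.
apply: le_trans (area_projection_le_hausdorff2 fL gL mG _).
  rewrite (_ : pi * _ / 2 = pi / 4 * (2 * r ^+ 2)); last by field.
  by rewrite EFinM lee_wpmul2l// lee_fin divr_ge0// pi_ge0.
by move=> [p q] /Gdisc/= /disc[x Sx [<- <-]]; exists x.
Qed.

End projection.

(** * Surfaces that are flat at every scale *)

Section flatness.
Context {R : realType}.
Implicit Types (x y u v w N e : 'rV[R]_3) (U S : set 'rV[R]_3) (s r : R).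

(** The slope [1 / 5] is below both [1 / 4], which leaves room for a direction
    outside the slabs of two scales with ratio 2, and the height [1 / 4] used in
    [splits_area]. *)
Definition flat_at S x s N :=
  forall y, S y -> enorm (y - x) <= s -> `|dotv (y - x) N| <= s / 5.

(** When the boundary is flat, this says that it separates the two caps cut off
    by the slab. *)
Definition splits U x s N := forall y, enorm y <= s ->
  (s / 5 < dotv y N -> U (x + y)) /\
  (dotv y N < - (s / 5) -> ~ closure U (x + y)).

(** Along a segment missing the boundary, being in [U] and being in its closure
    are the same condition, hence an open and closed one. *)
Lemma segment_meets_boundary U u v : open U -> U u -> ~ closure U v ->
  exists t : R, [/\ 0 <= t, t <= 1 & boundary U (u + t *: (v - u))].
Proof.
move=> oU Uu Uv; pose h (t : R) := u + t *: (v - u).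
have hc : continuous h.
  by move=> t; apply: cvgD; [exact: cvg_cst|apply: cvgZr_tmp; exact: cvg_id].
apply: contrapT => noS.
have clU t : 0 <= t <= 1 -> closure U (h t) -> U (h t).
  move=> /andP[t0 t1] clt; apply: contrapT => nU; apply: noS; exists t.
  by split=> //; split=> //; rewrite (interior_id U).1.
have : `[(0 : R), 1]%classic `&` h @^-1` U = `[(0 : R), 1]%classic.
  apply: (segment_connected (a := 0) (b := 1)).
  - exists 0; split; first by rewrite /= in_itv/= lexx ler01.
    by rewrite /= /h scale0r addr0.
  - by exists (h @^-1` U) => //; apply: open_comp => // t _; exact: hc.
  - exists (h @^-1` closure U).
      by apply: preimage_closed => [t _|]; [exact: hc|exact: closed_closure].
    apply/seteqP; split=> t [t01 Ut]; split=> //; first exact: subset_closure.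
    by apply: clU => //; move: t01; rewrite /= in_itv.
move=> /seteqP[_ /(_ 1)] /=; rewrite in_itv/= ler01 lexx => /(_ isT)[_].
by rewrite /h scale1r addrC subrK => /subset_closure.
Qed.

Lemma off_boundary U y : open U -> ~ boundary U y -> U y \/ ~ closure U y.
Proof.
move=> oU Uy; have [|nU] := pselect (U y); first by left.
by right=> cU; apply: Uy; split=> //; rewrite (interior_id U).1.
Qed.

Lemma enorm_convex u v t : 0 <= t -> t <= 1 ->
  enorm (u + t *: (v - u)) <= (1 - t) * enorm u + t * enorm v.
Proof.
move=> t0 t1; rewrite (_ : _ + _ = (1 - t) *: u + t *: v); last first.
  by apply/rowP => i; rewrite !mxE; ring.
apply: le_trans (ler_enormD _ _) _.
by rewrite !enormZ !ger0_norm ?subr_ge0.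
Qed.

(** A cap is convex and misses the boundary, so it cannot contain both an
    interior and an exterior point. *)
Lemma flat_cap U x s N u v : open U -> flat_at (boundary U) x s N ->
  enorm u <= s -> s / 5 < dotv u N -> enorm v <= s -> s / 5 < dotv v N ->
  U (x + u) -> U (x + v).
Proof.
move=> oU flat us uN vs vN Uu.
have cap w : enorm w <= s -> s / 5 < dotv w N -> ~ boundary U (x + w).
  move=> ws wN /flat; rewrite addrC addKr ?addrK => /(_ ws).
  by apply/negP; rewrite -ltNge (lt_le_trans wN)// ler_norm.
have [//|/(segment_meets_boundary oU Uu)[t [t0 t1]]] :=
  off_boundary oU (cap _ vs vN).
have t1' : 0 <= 1 - t by rewrite subr_ge0.
rewrite opprD addrACA subrr add0r -addrA => /cap; case.
- by apply: le_trans (enorm_convex u v t0 t1) _; have := ler_wpM2l t0 vs;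
    have := ler_wpM2l t1' us; lra.
- rewrite dotvDl dotvZl dotvBl; have [->|tn0] := eqVneq t 0; first by rewrite mul0r addr0.
  have tp : 0 < t by rewrite lt0r tn0.
  have := vN; rewrite -(ltr_pM2l tp) => vN'; have := ler_wpM2l t1' (ltW uN); lra.
Qed.

Lemma flat_atN S x s N : flat_at S x s N -> flat_at S x s (- N).
Proof. by move=> flat y Sy yx; rewrite dotvNr normrN; exact: flat. Qed.

(** One antipodal pair decides the sides of both caps. *)
Lemma flat_splits U x s N u : open U -> flat_at (boundary U) x s N ->
  enorm u <= s -> s / 5 < dotv u N -> U (x + u) -> ~ closure U (x - u) ->
  splits U x s N.
Proof.
move=> oU flat us uN Uu Uu' y ys; split=> yN; first exact: (flat_cap oU flat us uN ys yN).
have yN' : s / 5 < dotv y (- N) by rewrite dotvNr ltrNr.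
have [|Uy _|//] := @off_boundary U (x + y) oU.
  move=> /flat; rewrite addrC addKr ?addrK => /(_ ys).
  by apply/negP; rewrite -ltNge (lt_le_trans yN')// dotvNr -normrN ler_norm.
apply: Uu'; apply: subset_closure.
apply: (flat_cap oU (flat_atN flat) ys yN' _ _ Uy); rewrite ?enormN//.
by rewrite dotvNl dotvNr opprK.
Qed.

Lemma enorm_normalize u : u != 0 -> enorm ((enorm u)^-1 *: u) = 1.
Proof.
move=> u0; rewrite enormZ ger0_norm ?invr_ge0 ?enorm_ge0// mulVf//.
by rewrite enorm_eq0.
Qed.

Lemma sqr_cos_pi4 : cos (pi / 4 : R) ^+ 2 = 1 / 2.
Proof.
have := cos_mulr2n (pi / 4 : R).
rewrite (_ : _ *+ 2 = pi / 2 :> R) ?cos_pihalf; last by field.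
lra.
Qed.

Lemma cos_pi4_ge : 1 / 2 <= cos (pi / 4 : R).
Proof.
have : 0 <= cos (pi / 4 : R).
  apply: cos_ge0_pihalf; have p0 := pi_gt0 R.
  by apply/andP; split; lra.
have := sqr_cos_pi4; nra.
Qed.

(** Directions at most a right angle apart have a bisector at angle at most
    [pi / 4] from both. *)
Lemma bisector v N : enorm v = 1 -> enorm N = 1 -> 0 <= dotv v N ->
  exists w, [/\ enorm w = 1, cos (pi / 4) <= dotv w v & cos (pi / 4) <= dotv w N].
Proof.
move=> v1 N1 vN.
have v2 : dotv v v = 1 by rewrite -sqr_enorm v1 expr1n.
have N2 : dotv N N = 1 by rewrite -sqr_enorm N1 expr1n.
pose h := enorm (v + N).
have h2 : h ^+ 2 = 2 + 2 * dotv v N.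
  by rewrite sqr_enorm dotvDl !dotvDr (dotvC N v) v2 N2; ring.
have h0 : 0 < h by have := enorm_ge0 (v + N); rewrite -/h; nra.
have c2 := sqr_cos_pi4; have c0 := cos_pi4_ge.
have ch : cos (pi / 4) <= h / 2 by nra.
exists (h^-1 *: (v + N)); split.
- by rewrite enorm_normalize// -enorm_gt0.
- rewrite dotvZl dotvDl (dotvC N v) v2 (_ : 1 + _ = h ^+ 2 / 2); last by lra.
  by rewrite [leRHS](_ : _ = h / 2)//; field; rewrite gt_eqF.
- rewrite dotvZl dotvDl N2 (_ : _ + 1 = h ^+ 2 / 2); last by lra.
  by rewrite [leRHS](_ : _ = h / 2)//; field; rewrite gt_eqF.
Qed.

Lemma exists_unit_normal S x s N v : enorm N = 1 -> flat_at S x s N ->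
  exists N', [/\ enorm N' = 1, flat_at S x s N' & 0 <= dotv v N'].
Proof.
move=> N1 flat; have [vN|vN] := leP 0 (dotv v N); first by exists N.
exists (- N); split; [by rewrite enormN|exact: flat_atN|].
by rewrite dotvNr oppr_ge0 ltW.
Qed.

(** The bisector of the axis of the cones and the normal of the slab, and its
    opposite, point into the cones as well as into the caps. *)
Lemma cones_split U x s d v N : open U -> 0 < s -> s <= d ->
  enorm v = 1 -> enorm N = 1 -> flat_at (boundary U) x s N ->
  eball x d `&` translate x (cone_pos (pi / 4) v) `<=` U `|` [set x] ->
  eball x d `&` translate x (cone_neg (pi / 4) v) `<=` ~` closure U `|` [set x] ->
  exists2 N', enorm N' = 1 & splits U x s N'.
Proof.
move=> oU s0 sd v1 N1 flat cpos cneg.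
have [N' [N'1 flat' vN']] := exists_unit_normal v N1 flat.
have [w [w1 wv wN]] := bisector v1 N'1 vN'; have c := cos_pi4_ge.
have sw : enorm (s *: w) = s by rewrite enormZ w1 mulr1 gtr0_norm.
have sw0 : s *: w != 0 by rewrite -enorm_gt0 sw.
exists N' => //; apply: (@flat_splits U x s N' (s *: w)) => //.
- by rewrite sw.
- by rewrite dotvZl; nra.
- have [|//|/eqP] := cpos (x + s *: w); last first.
    by rewrite -[X in _ == X]addr0 (inj_eq (addrI x)) (negbTE sw0).
  split; first by rewrite /eball /= addrC addKr ?addrK sw.
  by exists (s *: w) => //; rewrite /cone_pos /= sw dotvZl ler_pM2l.
- have [|//|/eqP] := cneg (x - s *: w); last first.
    by rewrite -[X in _ == X]addr0 (inj_eq (addrI x)) oppr_eq0 (negbTE sw0).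
  split; first by rewrite /eball /= addrC addKr ?addrK enormN sw.
  by exists (- (s *: w)) => //; rewrite /cone_neg /= enormN sw dotvNl opprK dotvZl ler_pM2l.
Qed.

(** The slab at scale [s' <= 2 * s] has half-width less than [s / 2], so the
    bisector of the two normals, cut at length [s], ends in caps of both scales. *)
Lemma splits_step U x s s' N M : open U -> 0 < s -> s <= s' -> s' <= 2 * s ->
  enorm N = 1 -> splits U x s N -> enorm M = 1 -> flat_at (boundary U) x s' M ->
  exists2 M', enorm M' = 1 & splits U x s' M'.
Proof.
move=> oU s0 ss' s's N1 spl M1 flat.
have [M' [M'1 flat' NM']] := exists_unit_normal N M1 flat.
have [w [w1 wN wM]] := bisector N1 M'1 NM'; have c := cos_pi4_ge.
have sw : enorm (s *: w) = s by rewrite enormZ w1 mulr1 gtr0_norm.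
exists M' => //; apply: (@flat_splits U x s' M' (s *: w)) => //.
- by rewrite sw.
- by rewrite dotvZl; nra.
- have [|+ _] := spl (s *: w); first by rewrite sw.
  by apply; rewrite dotvZl; nra.
- have [|_] := spl (- (s *: w)); first by rewrite enormN sw.
  by apply; rewrite dotvNl dotvZl; nra.
Qed.

Lemma splits_propagate U x s r : open U -> 0 < s -> s <= r ->
  (exists2 N, enorm N = 1 & splits U x s N) ->
  (forall t, 0 < t -> t <= r -> exists2 N, enorm N = 1 & flat_at (boundary U) x t N) ->
  exists2 N, enorm N = 1 & splits U x r N.
Proof.
move=> oU s0 sr spl flat.
have [k rk] : exists k, r <= 2 ^+ k * s.
  exists (Num.truncn (r / s)).+1; rewrite -ler_pdivrMr//.
  apply: le_trans (ltW (truncnS_gt _)) _.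
  by rewrite -natrX ler_nat ltnW// ltn_expl.
elim: k r sr rk flat => [|k IH] r sr rk flat.
  by rewrite expr0 mul1r in rk; rewrite (_ : r = s)//; apply/eqP; rewrite eq_le rk.
have r0 := lt_le_trans s0 sr; have [M M1 flatM] := flat r r0 (lexx r).
have [r2|r2] := leP s (r / 2); last first.
  by have [N N1 splN] := spl; apply: splits_step splN M1 flatM => //; lra.
have [|t t0 tr|N N1 splN] := IH (r / 2) r2.
- by rewrite ler_pdivrMr// mulrAC -exprSr.
- by apply: flat => //; lra.
by apply: splits_step splN M1 flatM => //; lra.
Qed.

(** The cross product with the first basis vector is orthogonal to [u]; if it
    vanishes, [u] is parallel to that vector and orthogonal to the second one. *)
Lemma exists_unit_orth u : exists2 e, enorm e = 1 & dotv u e = 0.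
Proof.
have d1 (j : 'I_3) : enorm (delta_mx 0 j : 'rV[R]_3) = 1.
  rewrite /enorm /dotv (bigD1 j)//= big1 => [|i ij]; rewrite !mxE !eqxx/=.
    by rewrite mulr1 addr0 sqrtr1.
  by rewrite (negbTE ij) mul0r.
have [uc|uc] := eqVneq (crossv u (delta_mx 0 0)) 0; last first.
  exists ((enorm (crossv u (delta_mx 0 0)))^-1 *: crossv u (delta_mx 0 0)).
    exact: enorm_normalize.
  by rewrite dotvZr dotv_crossl mulr0.
exists (delta_mx 0 1); first exact: d1.
have := congr1 (fun w : 'rV[R]_3 => w 0 2) uc.
rewrite crossvE dotv3E !mxE/= !(mulr0, mulr1, add0r, addr0) => h.
lra.
Qed.

Lemma orthonormal_complement N : enorm N = 1 -> exists e1 e2,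
  [/\ enorm e1 = 1, enorm e2 = 1 & [/\ dotv N e1 = 0, dotv N e2 = 0 & dotv e1 e2 = 0]].
Proof.
move=> N1; have [e e1 Ne] := exists_unit_orth N.
exists e, (crossv N e); split=> //; last by rewrite dotv_crossl dotv_crossr.
by rewrite /enorm dotv_crossv Ne -!sqr_enorm e1 N1 !expr1n expr0n/= subr0 mulr1 sqrtr1.
Qed.

(** Lines parallel to the normal run from one cap to the other and cross the
    boundary, so its projection covers nearly the whole disc. *)
Lemma splits_area U x r N : open U -> 0 < r -> enorm N = 1 -> splits U x r N ->
  ((pi * r ^+ 2 / 2)%:E <= hausdorff2 (eball x r `&` boundary U))%E.
Proof.
move=> oU r0 N1 spl; have [e1 [e2 [e11 e21 [Ne1 Ne2 e12]]]] := orthonormal_complement N1.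
have dE : (dotv N N = 1) * (dotv e1 e1 = 1) * (dotv e2 e2 = 1).
  by rewrite -!sqr_enorm N1 e11 e21 expr1n.
have lip e : enorm e = 1 -> forall y z,
    `|dotv (y - x) e - dotv (z - x) e| <= enorm (y - z).
  move=> e_1 y z; rewrite -dotvBl opprB addrA subrK.
  by apply: le_trans (cauchy_schwarz _ _) _; rewrite e_1 mulr1.
apply: (disc_projection_hausdorff2 (lip e1 e11) (lip e2 e21) r0) => p q pq.
pose z t : 'rV[R]_3 := p *: e1 + q *: e2 + t *: N.
have zN t : dotv (z t) N = t.
  by rewrite !dotvDl !dotvZl (dotvC e1) (dotvC e2) Ne1 Ne2 dE !mulr0 !add0r mulr1.
have z1 t : dotv (z t) e1 = p.
  by rewrite !dotvDl !dotvZl (dotvC e2) e12 Ne1 dE !mulr0 !addr0 mulr1.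
have z2 t : dotv (z t) e2 = q.
  by rewrite !dotvDl !dotvZl e12 Ne2 dE !mulr0 addr0 add0r mulr1.
have zr t : t ^+ 2 <= r ^+ 2 / 16 -> enorm (z t) <= r.
  move=> tr; rewrite -ler_sqr ?nnegrE ?enorm_ge0 ?(ltW r0)// sqr_enorm.
  rewrite {2}/z !dotvDr !dotvZr zN z1 z2 -!expr2; lra.
have Uz : U (x + z (r / 4)).
  have [|+ _] := spl (z (r / 4)); first by apply: zr; rewrite expr_div_n; lra.
  by apply; rewrite zN; lra.
have Uz' : ~ closure U (x + z (- (r / 4))).
  have [|_] := spl (z (- (r / 4))); first by apply: zr; rewrite sqrrN expr_div_n; lra.
  by apply; rewrite zN; lra.
(* The height [r / 4] clears the slab, and [15 / 16 + (1 / 4) ^+ 2 = 1]. *)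
have [t [t0 t1 bz]] := segment_meets_boundary oU Uz Uz'.
pose k := (1 - 2 * t) * (r / 4).
have zE : x + z (r / 4) + t *: (x + z (- (r / 4)) - (x + z (r / 4))) = x + z k.
  by apply/rowP => i; rewrite /k !mxE; field.
rewrite zE in bz; exists (x + z k).
  split=> //; rewrite /eball /= addrC addKr ?addrK; apply: zr.
  rewrite /k exprMn expr_div_n.
  have : (1 - 2 * t) ^+ 2 <= 1 by nra.
  have : 0 <= r ^+ 2 / 16 by rewrite divr_ge0 ?sqr_ge0.
  nra.
by rewrite (addrC x) addrK z1 z2.
Qed.

(** Nearly coplanar quadruples at scale [s] force flatness at scale [s]: take
    as normal that of a triangle of substantial area; failing that, the points
    are near a line, or all near [x]. *)
Lemma small_triple_flat S x s : 0 < s ->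
  (forall a b c, S a -> S b -> S c ->
     enorm (a - x) <= s -> enorm (b - x) <= s -> enorm (c - x) <= s ->
     `|tripv (a - x) (b - x) (c - x)| < s ^+ 3 / 125) ->
  exists2 N, enorm N = 1 & flat_at S x s N.
Proof.
move=> s0 small.
have [[b [c [[Sb Sc] [bs cs] bc]]]|nobc] := pselect (exists b c,
    [/\ S b /\ S c, enorm (b - x) <= s /\ enorm (c - x) <= s &
        s ^+ 2 / 25 <= enorm (crossv (b - x) (c - x))]).
  have n0 : 0 < enorm (crossv (b - x) (c - x)).
    by apply: lt_le_trans bc; rewrite divr_gt0 ?exprn_gt0.
  set w := crossv _ _ in bc n0.
  exists ((enorm w)^-1 *: w); first by rewrite enorm_normalize// -enorm_gt0.
  move=> a Sa ax; rewrite dotvZr normrM gtr0_norm ?invr_gt0// mulrC ler_pdivrMr//.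
  apply: le_trans (ltW (small a b c Sa Sb Sc ax bs cs)) _.
  have := exprn_gt0 2 s0; nra.
have {}nobc a b : S a -> S b -> enorm (a - x) <= s -> enorm (b - x) <= s ->
    enorm (crossv (a - x) (b - x)) < s ^+ 2 / 25.
  move=> Sa Sb ax bx; rewrite ltNge; apply/negP => ab; apply: nobc.
  by exists a, b.
have [[b [Sb bs bl]]|nob] := pselect (exists b,
    [/\ S b, enorm (b - x) <= s & s / 5 <= enorm (b - x)]).
  have [e e1 be] := exists_unit_orth (b - x).
  exists e => // a Sa ax; set u := a - x; set w := b - x in be *.
  have w0 : 0 < enorm w by apply: lt_le_trans bl; rewrite divr_gt0.
  have uw := nobc a b Sa Sb ax bs; rewrite -/u -/w in uw bl.
  (* The Binet-Cauchy identity bounds [dotv u e] by the distance from [u] to the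
     line spanned by [w]. *)
  have binet : dotv (crossv u w) (crossv e w) = dotv u e * enorm w ^+ 2.
    rewrite sqr_enorm [LHS](_ : _ = dotv u e * dotv w w - dotv u w * dotv w e).
      by rewrite be mulr0 subr0.
    by rewrite !dotv3E !crossvE; ring.
  have : `|dotv u e| * enorm w ^+ 2 <= s ^+ 2 / 25 * enorm w.
    rewrite -[X in _ * X]ger0_norm ?sqr_ge0// -normrM -binet.
    apply: le_trans (cauchy_schwarz _ _) _; apply: ler_pM; rewrite ?enorm_ge0 ?(ltW uw)//.
    by apply: le_trans (enorm_crossv_le _ _) _; rewrite e1 mul1r.
  rewrite expr2 mulrA ler_pM2r// => h; have := normr_ge0 (dotv u e); nra.
have [e e1 _] := exists_unit_orth x.
exists e => // a Sa ax; apply: le_trans (cauchy_schwarz _ _) _; rewrite e1 mulr1.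
by rewrite leNgt; apply/negP => /ltW asl; apply: nob; exists a.
Qed.

End flatness.

(** * Lower bounds for the energy *)

Section energy.
Context {R : realType}.

(** The integral of a nonnegative function is the supremum of the integrals of
    the simple functions below it, and [c * \1_A] is one of these. *)
Lemma integral_ge_const d (T : measurableType d) (nu : {measure set T -> \bar R})
    (D A : set T) (f : T -> \bar R) (c m : R) :
  measurable A -> A `<=` D -> 0 <= c -> (m%:E <= nu A)%E ->
  (forall x, D x -> (0 <= f x)%E) -> (forall x, A x -> (c%:E <= f x)%E) ->
  ((c * m)%:E <= \int[nu]_(x in D) f x)%E.
Proof.
move=> mA AD c0 mnu f0 cf; rewrite ge0_integralE//.
apply: (@le_trans _ _ (c%:E * nu A)%E); first by rewrite EFinM lee_wpmul2l.
apply: ereal_sup_ubound => /=.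
exists (scale_nnsfun (indic_nnsfun R mA) c0) => [x|]; last first.
  transitivity (c%:E * sintegral nu \1_A)%E; first exact: (sintegralrM nu c (indic_nnsfun R mA)).
  by rewrite sintegral_indic.
change ((c * \1_A x)%:E <= (f \_ D) x)%E.
rewrite /patch indicE; case: ifPn => [|/negP] xD.
  case: (boolP (x \in A)) => xA; rewrite ?mulr1 ?mulr0; last exact/f0/set_mem.
  exact/cf/set_mem.
case: (boolP (x \in A)) => xA; rewrite ?mulr0//.
by exfalso; apply/xD/mem_set/AD/set_mem.
Qed.

Lemma menger_energy_ge (p c m : R) (Sigma : set 'rV[R]_3) (A : 'I_4 -> set 'rV[R]_3) :
  0 <= c -> 0 <= m -> (forall i, closed (A i)) -> (forall i, A i `<=` Sigma) ->
  (forall i, m%:E <= hausdorff2 (A i))%E ->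
  (forall x0 x1 x2 x3, A 0 x0 -> A 1 x1 -> A 2 x2 -> A 3 x3 ->
     c <= menger_kernel x0 x1 x2 x3 `^ p) ->
  ((c * m ^+ 4)%:E <= menger_energy p Sigma)%E.
Proof.
move=> c0 m0 clA AS mA cK.
have mcA i : measurable (A i : set (caratheodory_type (@hausdorff2 R 3))).
  exact: closed_caratheodory (clA i).
rewrite (_ : c * m ^+ 4 = c * m * m * m * m); last by ring.
apply: (integral_ge_const (mcA 3) (AS 3) _ (mA 3)).
- by rewrite !mulr_ge0.
- move=> x3 _; apply: integral_ge0 => x2 _; apply: integral_ge0 => x1 _.
  by apply: integral_ge0 => x0 _; rewrite lee_fin powR_ge0.
move=> x3 Ax3; apply: (integral_ge_const (mcA 2) (AS 2) _ (mA 2)).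
- by rewrite !mulr_ge0.
- move=> x2 _; apply: integral_ge0 => x1 _.
  by apply: integral_ge0 => x0 _; rewrite lee_fin powR_ge0.
move=> x2 Ax2; apply: (integral_ge_const (mcA 1) (AS 1) _ (mA 1)).
- by rewrite !mulr_ge0.
- by move=> x1 _; apply: integral_ge0 => x0 _; rewrite lee_fin powR_ge0.
move=> x1 Ax1; apply: (integral_ge_const (mcA 0) (AS 0) _ (mA 0)) => //.
- by move=> x0 _; rewrite lee_fin powR_ge0.
by move=> x0 Ax0; rewrite lee_fin cK.
Qed.

Lemma not_coplanar (x0 x1 x2 x3 : 'rV[R]_3) :
  tripv (x1 - x0) (x2 - x0) (x3 - x0) != 0 -> ~ coplanar x0 x1 x2 x3.
Proof.
move=> t0 [v [k [v0 [h0 h1 h2 h3]]]].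
have := tripv_cramer (x1 - x0) (x2 - x0) (x3 - x0) v.
rewrite !(dotvC v) !dotvBl !(dotvC _ v) h0 h1 h2 h3 subrr !scale0r !addr0.
by move/eqP; rewrite scaler_eq0 (negbTE t0) (negbTE v0).
Qed.

Lemma triangle_area_le (a b c : 'rV[R]_3) L : 0 <= L ->
  enorm (b - a) <= L -> enorm (c - a) <= L -> triangle_area a b c <= L ^+ 2 / 2.
Proof.
move=> L0 ba ca; rewrite /triangle_area -dotv_crossv ler_wpM2r//.
by apply: le_trans (enorm_crossv_le _ _) _; rewrite expr2 ler_pM ?enorm_ge0.
Qed.

Lemma triangle_area_ge0 (a b c : 'rV[R]_3) : 0 <= triangle_area a b c.
Proof. by rewrite /triangle_area divr_ge0 ?sqrtr_ge0. Qed.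

(** A tetrahedron of volume [t / 6] has [V / (A * diam ^+ 2)] at least
    [(t / 6) / (2 * L ^+ 2 * L ^+ 2)] if its edges have length at most [L]. *)
Lemma menger_kernel_ge (x0 x1 x2 x3 : 'rV[R]_3) (t L : R) : 0 < t -> 0 <= L ->
  t <= `|tripv (x1 - x0) (x2 - x0) (x3 - x0)| ->
  {in [:: x0; x1; x2; x3] &, forall x y, enorm (x - y) <= L} ->
  t / (12 * L ^+ 4) <= menger_kernel x0 x1 x2 x3.
Proof.
move=> t0 L0 tT dL; set T := tripv _ _ _ in tT.
have T0 : 0 < `|T| by exact: lt_le_trans tT.
rewrite /menger_kernel asboolF; last by apply: not_coplanar; rewrite -normr_gt0.
have in_mem x : [set x0; x1; x2; x3] x -> x \in [:: x0; x1; x2; x3].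
  by rewrite !inE => -[[[]|]|] ->; rewrite eqxx ?orbT.
have diamE : ediam [set x0; x1; x2; x3] = (tetra_diam x0 x1 x2 x3)%:E.
  rewrite fineK// ge0_fin_numE ?ediam_ge0//.
  apply: le_lt_trans (ediam_le (d := L) _ _) (ltry _) => // x y /in_mem xi /in_mem yi.
  exact: dL.
have d0 : 0 < tetra_diam x0 x1 x2 x3.
  rewrite -lte_fin -diamE; apply: lt_le_trans (enorm_le_ediam (x := x1) (y := x0) _ _).
  - rewrite lte_fin enorm_gt0; apply: contraTneq T0 => x10.
    by rewrite /T x10 tripvE !mxE !mul0r !addr0 normr0 ltxx.
  - by left; left; right.
  - by left; left; left.
have dleL : tetra_diam x0 x1 x2 x3 <= L.
  rewrite -lee_fin -diamE; apply: ediam_le => // x y /in_mem xi /in_mem yi.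
  exact: dL.
have A0 : 0 < tetra_area x0 x1 x2 x3.
  rewrite /tetra_area -!addrA ltr_pwDl ?addr_ge0 ?triangle_area_ge0//.
  rewrite /triangle_area -dotv_crossv divr_gt0// -/(enorm _) enorm_gt0.
  apply: contraTneq T0 => x12.
  rewrite /T (_ : tripv _ _ _ = dotv (crossv (x1 - x0) (x2 - x0)) (x3 - x0)).
    by rewrite x12 dotv3E !mxE !mul0r !addr0 normr0 ltxx.
  by rewrite tripvE dotv3E !crossvE; ring.
have AL : tetra_area x0 x1 x2 x3 <= 2 * L ^+ 2.
  have tri : {in [:: x0; x1; x2; x3] & &, forall a b c, triangle_area a b c <= L ^+ 2 / 2}.
    by move=> a b c ai bi ci; apply: triangle_area_le => //; exact: dL.
  have := tri x0 x1 x2; have := tri x0 x1 x3; have := tri x0 x2 x3; have := tri x1 x2 x3.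
  rewrite !inE !eqxx !orbT => /(_ isT isT isT) h1 /(_ isT isT isT) h2.
  move=> /(_ isT isT isT) h3 /(_ isT isT isT) h4; rewrite /tetra_area; lra.
have L4 : 0 < L ^+ 4 by rewrite exprn_gt0// (lt_le_trans d0).
have AdL : tetra_area x0 x1 x2 x3 * tetra_diam x0 x1 x2 x3 ^+ 2 <= 2 * L ^+ 4.
  rewrite (_ : 2 * L ^+ 4 = 2 * L ^+ 2 * L ^+ 2); last by ring.
  by rewrite ler_pM ?(ltW A0) ?sqr_ge0// ler_sqr ?nnegrE// ltW.
rewrite ler_pdivlMr; last by rewrite mulr_gt0 ?exprn_gt0.
apply: (@le_trans _ _ (t / 6)); last by rewrite /tetra_volume det_tripv -/T; lra.
rewrite (_ : t / 6 = t / (12 * L ^+ 4) * (2 * L ^+ 4)); last first.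
  by field; rewrite gt_eqF// (lt_le_trans d0).
by rewrite ler_wpM2l// divr_ge0 ?mulr_ge0// ltW.
Qed.

End energy.

(** * Fat tetrahedra *)

Section fat_tetrahedra.
Context {R : realType}.
Implicit Types (U S : set 'rV[R]_3) (s r : R).

(** Fatness is measured against a scale [s] and not against the diameter; the
    constant is the one below which [small_triple_flat] yields a slab. *)
Definition fat_tetrahedron S s (x0 x1 x2 x3 : 'rV[R]_3) :=
  [/\ 0 < s, [/\ S x0, S x1, S x2 & S x3],
      [/\ enorm (x1 - x0) <= s, enorm (x2 - x0) <= s & enorm (x3 - x0) <= s] &
      s ^+ 3 / 125 <= `|tripv (x1 - x0) (x2 - x0) (x3 - x0)|].

(** Without a fat tetrahedron at any scale up to [r] the boundary is flat at all
    these scales, and the sides determined by the cones at a tiny scale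
    propagate up to scale [r]. *)
Lemma small_area_fat U x v d r : open U -> boundary U x ->
  enorm v = 1 -> 0 < d -> 0 < r ->
  eball x d `&` translate x (cone_pos (pi / 4) v) `<=` U `|` [set x] ->
  eball x d `&` translate x (cone_neg (pi / 4) v) `<=` ~` closure U `|` [set x] ->
  (hausdorff2 (eball x r `&` boundary U) < (pi * r ^+ 2 / 2)%:E)%E ->
  exists s x1 x2 x3, s <= r /\ fat_tetrahedron (boundary U) s x x1 x2 x3.
Proof.
move=> oU Ux v1 d0 r0 cpos cneg small; apply: contrapT => nofat.
have flat t : 0 < t -> t <= r -> exists2 N, enorm N = 1 & flat_at (boundary U) x t N.
  move=> t0 tr; apply: small_triple_flat => // a b c Ua Ub Uc ax bx cx.
  by rewrite ltNge; apply/negP => fat; apply: nofat; exists t, a, b, c.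
pose s := Num.min d r.
have s0 : 0 < s by rewrite lt_min d0.
have sr : s <= r by rewrite ge_min lexx orbT.
have [M M1 flatM] := flat s s0 sr.
have spl : exists2 N, enorm N = 1 & splits U x s N.
  by apply: (cones_split oU s0 _ v1 M1 flatM cpos cneg); rewrite ge_min lexx.
have [N N1 splN] := splits_propagate oU s0 sr spl flat.
by have := splits_area oU r0 N1 splN; rewrite leNgt small.
Qed.

Lemma tripv_stable (a b c a' b' c' : 'rV[R]_3) s d : 0 <= d -> 10 * d <= s ->
  enorm a <= s -> enorm b <= s -> enorm c <= s ->
  enorm (a' - a) <= d -> enorm (b' - b) <= d -> enorm (c' - c) <= d ->
  `|tripv a b c| - 4 * (d * s ^+ 2) <= `|tripv a' b' c'|.
Proof.
move=> d0 ds as_ bs cs aa bb cc.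
have near (u u' : 'rV[R]_3) : enorm u <= s -> enorm (u' - u) <= d ->
    enorm u' <= 11 / 10 * s.
  by move=> us uu; rewrite -(subrK u u'); apply: le_trans (ler_enormD _ _) _; lra.
have bs' := near b b' bs bb; have cs' := near c c' cs cc.
have tle (u v w : 'rV[R]_3) i j k : enorm u <= i -> enorm v <= j -> enorm w <= k ->
    `|tripv u v w| <= i * (j * k).
  move=> ui vj wk; apply: le_trans (tripv_le _ _ _) _.
  by rewrite !ler_pM ?mulr_ge0 ?enorm_ge0.
have h1 := tle _ _ _ _ _ _ aa bs' cs'; have h2 := tle _ _ _ _ _ _ as_ bb cs'.
have h3 := tle _ _ _ _ _ _ as_ bs cc.
have hT : `|tripv a' b' c' - tripv a b c| <= 4 * (d * s ^+ 2).
  rewrite tripv_perturb; apply: le_trans (ler_normD _ _) _.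
  apply: le_trans (lerD (ler_normD _ _) (lexx _)) _.
  have ds2 : 0 <= d * s ^+ 2 by rewrite mulr_ge0 ?sqr_ge0.
  rewrite (_ : d * _ = 121 / 100 * (d * s ^+ 2)) in h1; last by field.
  rewrite (_ : s * _ = 11 / 10 * (d * s ^+ 2)) in h2; last by field.
  rewrite (_ : s * _ = d * s ^+ 2) in h3; last by ring.
  lra.
have := ler_normD (tripv a' b' c') (tripv a b c - tripv a' b' c').
by rewrite addrC subrK distrC; lra.
Qed.

(** Moving the vertices by at most [s / 2000] keeps the kernel comparable to
    [1 / s], so the energy is at least [(c / s) ^ p] times the fourth power of
    the smallest mass of a ball of radius [s / 2000]. *)
Lemma fat_energy p m S s x0 x1 x2 x3 : 0 <= p -> 0 <= m -> closed S ->
  fat_tetrahedron S s x0 x1 x2 x3 ->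
  (forall y, S y -> (m%:E <= hausdorff2 (eball y (s / 2000) `&` S))%E) ->
  ((((12 * 81 * 250)^-1 / s) `^ p * m ^+ 4)%:E <= menger_energy p S)%E.
Proof.
move=> p0 m0 clS [s0 [S0 S1 S2 S3] [x10 x20 x30] fat].
have sE : s = 10 * (10 * (20 * (s / 2000))) by field.
move: (s / 2000) sE => e sE mS.
have e0 : 0 < e by move: s0; rewrite sE; clear; lra.
pose A (i : 'I_4) := eball (tnth [tuple x0; x1; x2; x3] i) e `&` S.
have SA (i : 'I_4) : S (tnth [tuple x0; x1; x2; x3] i).
  have /allP/(_ _ (mem_tnth i _)) : all (fun y => `[< S y >]) [tuple x0; x1; x2; x3].
    by rewrite /= !asboolT.
  by move/asboolP.
apply: (menger_energy_ge (A := A)); [exact: powR_ge0|exact: m0|..].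
- by move=> i; apply: closedI => //; exact: closed_eball.
- by move=> i y [].
- by move=> i; exact: mS (SA i).
move=> y0 y1 y2 y3 [/= y00 _] [/= y11 _] [/= y22 _] [/= y33 _].
have {}y00 : enorm (y0 - x0) <= e by [].
have {}y11 : enorm (y1 - x1) <= e by [].
have {}y22 : enorm (y2 - x2) <= e by [].
have {}y33 : enorm (y3 - x3) <= e by [].
have edge (y x : 'rV[R]_3) : enorm (y - x) <= e ->
    enorm ((y - y0) - (x - x0)) <= 2 * e.
  move=> yx; rewrite (_ : _ - _ = (y - x) - (y0 - x0)); last first.
    by apply/rowP => i; rewrite !mxE; ring.
  apply: le_trans (ler_enormD _ _) _; rewrite enormN.
  by move: yx y00; clear; lra.
have far (y x : 'rV[R]_3) : enorm (y - x) <= e -> enorm (x - x0) <= s ->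
    enorm (y - x0) <= 3 / 2 * s.
  move=> yx xx; apply: le_trans (ler_enorm_distD x _ _) _.
  by move: yx xx sE e0; clear; lra.
(* [4 * (2 * e) * s ^+ 2] is half of [s ^+ 3 / 125], as [s = 2000 * e]. *)
have stable : s ^+ 3 / 250 <= `|tripv (y1 - y0) (y2 - y0) (y3 - y0)|.
  apply: le_trans (tripv_stable _ _ x10 x20 x30 (edge _ _ y11) (edge _ _ y22) (edge _ _ y33)).
  - move: fat; rewrite (_ : 4 * _ = s ^+ 3 / 250); first by clear; lra.
    by rewrite sE; field.
  - by move: e0; clear; lra.
  - by move: e0 sE; clear; lra.
have near0 : {in [:: y0; y1; y2; y3], forall y, enorm (y - x0) <= 3 / 2 * s}.
  move=> y; rewrite !inE => /or4P[] /eqP ->.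
  - by move: y00 sE e0; clear; lra.
  - exact: far y11 x10.
  - exact: far y22 x20.
  - exact: far y33 x30.
have kernel_ge : (12 * 81 * 250)^-1 / s <= menger_kernel y0 y1 y2 y3.
  apply: le_trans (menger_kernel_ge (t := s ^+ 3 / 250) (L := 3 * s) _ _ stable _).
  - by rewrite le_eqVlt; apply/orP; left; apply/eqP; field; rewrite gt_eqF.
  - by move: (exprn_gt0 3 s0); clear; lra.
  - by apply: mulr_ge0 => //; exact: ltW.
  move=> y z /near0 yx /near0 zx; apply: le_trans (ler_enorm_distD x0 _ _) _.
  by rewrite (enormBC x0); move: yx zx; clear; lra.
have c0 : 0 <= (12 * 81 * 250)^-1 / s by apply: divr_ge0 (ltW s0); lra.
apply: ge0_ler_powR => //; exact: le_trans kernel_ge.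
Qed.

(** Two factors [s] per vertex against [s `^ - p] from the kernel. *)
Lemma fat_energy_scale p E k S s x0 x1 x2 x3 : 8 < p -> 0 <= k -> closed S ->
  fat_tetrahedron S s x0 x1 x2 x3 ->
  (forall y, S y -> ((k * (s / 2000) ^+ 2)%:E <= hausdorff2 (eball y (s / 2000) `&` S))%E) ->
  (menger_energy p S <= E%:E)%E ->
  (12 * 81 * 250)^-1 `^ p * 2000^-1 ^+ 8 * k ^+ 4 <= E * s `^ (p - 8).
Proof.
move=> p8 k0 clS fat kS ES; have [s0 _ _ _] := fat.
have p0 : 0 <= p by lra.
have m0 : 0 <= k * (s / 2000) ^+ 2 by rewrite mulr_ge0 ?sqr_ge0.
have := le_trans (fat_energy p0 m0 clS fat kS) ES; rewrite lee_fin => h.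
have sp : 0 < s `^ (p - 8) by exact: powR_gt0.
have c0 : 0 <= (12 * 81 * 250)^-1 :> R by lra.
move: (_^-1) c0 h => c c0 h.
have spE : (c / s) `^ p * (s `^ (p - 8) * s ^+ 8) = c `^ p.
  rewrite -powR_mulrn ?(ltW s0)// -powRD; last by rewrite (gt_eqF s0) implybT.
  by rewrite subrK -powRM ?divr_ge0 ?(ltW s0)// divfK// gt_eqF.
apply: le_trans (ler_wpM2r (ltW sp) h); rewrite -spE.
by rewrite le_eqVlt; apply/orP; left; apply/eqP; field.
Qed.

(** By Hadamard's inequality the edges of a fat tetrahedron are comparable to
    its scale, so Ahlfors regularity applies at radius [s / 2000]. *)
Lemma fat_diam S s x0 x1 x2 x3 : fat_tetrahedron S s x0 x1 x2 x3 ->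
  ((s / 2000)%:E <= ediam S)%E.
Proof.
move=> [s0 [S0 S1 _ _] [_ x20 x30] fat].
apply: le_trans (enorm_le_ediam S1 S0); rewrite lee_fin.
have h : `|tripv (x1 - x0) (x2 - x0) (x3 - x0)| <= enorm (x1 - x0) * (s * s).
  by apply: le_trans (tripv_le _ _ _) _; rewrite ler_wpM2l ?ler_pM ?enorm_ge0.
have := le_trans fat h; rewrite (_ : s ^+ 3 / 125 = s / 125 * (s * s)); last by field.
by rewrite ler_pM2r ?mulr_gt0// => {}h; lra.
Qed.

(** Only the existence of the two constants matters below: [c / s] bounds the
    kernel, and [q * s] is the admissible displacement of the vertices. *)
Lemma fat_constants : exists c q : R, [/\ 0 < c <= 1, 0 < q <= 1 / 2,
    forall S s x0 x1 x2 x3, fat_tetrahedron S s x0 x1 x2 x3 ->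
      ((q * s)%:E <= ediam S)%E &
    forall p E k S s x0 x1 x2 x3, 8 < p -> 0 <= k -> closed S ->
      fat_tetrahedron S s x0 x1 x2 x3 ->
      (forall y, S y ->
        ((k * (q * s) ^+ 2)%:E <= hausdorff2 (eball y (q * s) `&` S))%E) ->
      (menger_energy p S <= E%:E)%E ->
      c `^ p * q ^+ 8 * k ^+ 4 <= E * s `^ (p - 8)].
Proof.
exists (12 * 81 * 250)^-1, 2000^-1; split.
- by apply/andP; split; lra.
- by apply/andP; split; lra.
- by move=> S s x0 x1 x2 x3 /fat_diam; rewrite mulrC.
move=> p E k S s x0 x1 x2 x3 p8 k0 clS fat mS; rewrite (mulrC _ s) in mS.
exact: fat_energy_scale fat mS.
Qed.

End fat_tetrahedra.

(** * The stopping radius *)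

Section stopping_radius.
Context {R : realType}.
Implicit Types (S : set 'rV[R]_3) (r : R).

(** The infimum of the deficient radii is the largest scale below which the area
    bound holds on all of [S]. *)
Definition deficient S r := 0 < r /\
  exists2 x, S x & (hausdorff2 (eball x r `&` S) < (pi * r ^+ 2 / 2)%:E)%E.

(** The inequality is strict and thus survives a small decrease of the radius
    and a small move of the centre into a dense subset. *)
Lemma deficient_dense S S' r : S `<=` closure S' -> deficient S r ->
  exists r' x', [/\ 0 < r', r' < r, S' x' &
    (hausdorff2 (eball x' r' `&` S) < (pi * r' ^+ 2 / 2)%:E)%E].
Proof.
move=> SS' [r0 [x Sx small]]; set H := hausdorff2 _ in small.
have HE : H = (fine H)%:E.
  by rewrite fineK// ge0_fin_numE ?hausdorff2_ge0// (lt_trans small) ?ltry.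
move: small; rewrite HE lte_fin; set h := fine H => hr.
have h0 : 0 <= h by rewrite fine_ge0 ?hausdorff2_ge0.
have p0 := pi_gt0 R.
(* The radius at which the bound would hold with equality. *)
pose q := Num.sqrt (2 * h / pi); have q0 : 0 <= q by exact: sqrtr_ge0.
have q2 : q ^+ 2 = 2 * h / pi by rewrite sqr_sqrtr// divr_ge0 ?mulr_ge0 ?(ltW p0).
have hq : h = pi * q ^+ 2 / 2.
  by rewrite q2 [pi * _]mulrC divfK ?gt_eqF// mulrC mulKf.
have qr : q < r.
  rewrite -ltr_sqr ?nnegrE ?(ltW r0)// q2 ltr_pdivrMr//; lra.
pose r' := (q + r) / 2.
have qr' : q < r' by rewrite /r'; lra.
have rr' : r' < r by rewrite /r'; lra.
have e0 : 0 < r - r' by rewrite subr_gt0.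
have [x' Sx' xx'] := (closure_enormP S' x).1 (SS' _ Sx) _ e0.
exists r', x'; split => //; first exact: le_lt_trans qr'.
apply: (@le_lt_trans _ _ H).
  apply: le_hausdorff2 => y [yx' Sy]; split => //; rewrite /eball /= in yx' *.
  by apply: le_trans (ler_enorm_distD x' _ _) _; lra.
rewrite HE lte_fin -/h hq ltr_pM2r// ltr_pM2l// ltr_sqr ?nnegrE//.
exact: le_trans q0 (ltW qr').
Qed.

(** The cones are available at the points of the dense subset only, hence the
    passage through [deficient_dense]. *)
Lemma deficient_fat S r : admissible S -> deficient S r ->
  exists s x0 x1 x2 x3, s < r /\ fat_tetrahedron S s x0 x1 x2 x3.
Proof.
move=> [_ _ [U [[_ oU _ _] SU _ [S' [S'S SS'] cones]]]] /(deficient_dense SS').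
move=> [r' [x [r'0 r'r S'x small]]].
have [v [d [v1 d0 cpos cneg]]] := cones x S'x.
have Ux : boundary U x by rewrite -SU; exact: S'S.
rewrite SU in small *.
have [s [x1 [x2 [x3 [sr' fat]]]]] := small_area_fat oU Ux v1 d0 r'0 cpos cneg small.
by exists s, x, x1, x2, x3; split => //; exact: le_lt_trans r'r.
Qed.

End stopping_radius.

Theorem theorem3p1 (R : realType) :
  exists2 alpha : R, 0 < alpha &
    forall (p E : R) (Sigma : set 'rV[R]_3),
      8 < p -> 0 < E -> admissible Sigma ->
      (menger_energy p Sigma <= E%:E)%E ->
      forall x : 'rV[R]_3, Sigma x ->
      forall r : R, 0 < r -> r <= (alpha `^ (5 * p) / E) `^ (1 / (p - 8)) ->
        ((pi * r ^+ 2 / 2)%:E <= hausdorff2 (eball x r `&` Sigma))%E.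
Proof.
have [c [q [/andP[c0 c1] /andP[q0 q12] fat_large fat_scale]]] := @fat_constants R.
have q1 : q <= 1 by move: q12; clear; lra.
pose alpha := c * q; have a0 : 0 < alpha by rewrite mulr_gt0.
have a1 : alpha <= 1 by rewrite mulr_ile1// ltW.
exists alpha => // p E Sigma p8 E0 adm energy x Sx r r0 rR.
have [cS _ [U [_ _ [K K0 ahlfors] _]]] := adm.
have clS : closed Sigma by apply: compact_closed => //; exact: norm_hausdorff.
have p80 : 0 < p - 8 by lra.
rewrite leNgt; apply/negP => small.
have defr : deficient Sigma r by split=> //; exists x.
have lt_scale s C : 0 < s -> 0 < C -> s < (C / E) `^ (1 / (p - 8)) -> E * s `^ (p - 8) < C.
  move=> s0 C0 sC; rewrite mulrC -ltr_pdivlMr//.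
  have : s `^ (p - 8) < ((C / E) `^ (1 / (p - 8))) `^ (p - 8).
    by apply: gt0_ltr_powR => //; rewrite nnegrE ?(ltW s0)// powR_ge0.
  by rewrite -powRrM divfK ?gt_eqF// powRr1// divr_ge0 ?ltW.
have lb0 : lbound (deficient Sigma) 0 by move=> t [/ltW].
have hlb : has_lbound (deficient Sigma) by exists 0.
have hi : has_inf (deficient Sigma) by split => //; exists r.
have [D0|D0] := ltP 0 (inf (deficient Sigma)).
  (* Balls of radius [q * s < t / 2] lie below the infimum, hence are not deficient. *)
  have [t [dt tr tD]] : exists t, [/\ deficient Sigma t, t <= r & t < 2 * inf (deficient Sigma)].
    have [rD|rD] := ltP r (2 * inf (deficient Sigma)); first by exists r.
    have [t dt tD] := inf_adherent D0 hi.
    by exists t; split=> //; move: tD rD; clear; lra.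
  have [s [x0 [x1 [x2 [x3 [st fat]]]]]] := deficient_fat adm dt.
  have [s0 _ _ _] := fat.
  have big y : Sigma y -> ((1 * (q * s) ^+ 2)%:E <= hausdorff2 (eball y (q * s) `&` Sigma))%E.
    move=> Sy; apply: (@le_trans _ _ (pi * (q * s) ^+ 2 / 2)%:E).
      rewrite lee_fin mul1r -mulrA mulrCA ler_peMr ?sqr_ge0//.
      by have := pi_ge2 R; clear; lra.
    rewrite leNgt; apply/negP => ysmall.
    have rho0 : 0 < q * s by exact: mulr_gt0.
    have := ge_inf hlb (conj rho0 (ex_intro2 _ _ y Sy ysmall)).
    have := ler_wpM2r (ltW s0) q12; by move: st tD; clear; lra.
  have := fat_scale _ _ _ _ _ _ _ _ _ p8 ler01 clS fat big energy.
  rewrite expr1n mulr1 leNgt => /negP; apply.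
  apply: (@lt_le_trans _ _ (alpha `^ (5 * p))).
    apply: lt_scale => //; first exact: powR_gt0.
    exact: lt_le_trans (le_trans tr rR).
  apply: (@le_trans _ _ (alpha `^ p)).
    by apply: ger_powR; [rewrite a0|lra].
  rewrite powRM ?(ltW c0) ?(ltW q0)// ler_wpM2l ?powR_ge0// -powR_mulrn ?(ltW q0)//.
  by apply: ger_powR; [rewrite q0|exact: ltW].
(* Deficient radii are arbitrarily small: the constant may depend on [K]. *)
pose C : R := c `^ p * q ^+ 8 * K^-1 ^+ 4.
have C0 : 0 < C by rewrite /C !mulr_gt0 ?powR_gt0 ?exprn_gt0 ?invr_gt0.
have R0 : 0 < (C / E) `^ (1 / (p - 8)) by rewrite powR_gt0// divr_gt0.
have [t dt tR] := inf_adherent R0 hi.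
have [s [x0 [x1 [x2 [x3 [st fat]]]]]] := deficient_fat adm dt.
have [s0 _ _ _] := fat.
have big y : Sigma y -> ((K^-1 * (q * s) ^+ 2)%:E <= hausdorff2 (eball y (q * s) `&` Sigma))%E.
  move=> Sy; rewrite setIC; apply: (ahlfors y (q * s) Sy _ (fat_large _ _ _ _ _ _ fat)).2.
  exact: mulr_gt0.
have K1 : 0 <= K^-1 by rewrite invr_ge0 ltW.
have := fat_scale _ _ _ _ _ _ _ _ _ p8 K1 clS fat big energy.
rewrite leNgt => /negP; apply; apply: lt_scale => //.
by move: st tR D0; clear; lra.
Qed.
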